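(* Let $A$ and $B$ be linear differential operators on $\mathbb R^d$. If $A$ is a silvern differential transmutation of $B$ and if $B$ satisfies the Runge property with point controls on $\mathbb R^d$, then $A$ satisfies the Runge property with point controls on $\mathbb R^d$.
   Context: Let $d,n,m,p,q\in\mathbb N^*$. A linear differential operator on $\mathbb R^d$ is a finite-order linear differential operator $\sum_{|\alpha|\le k}C_\alpha(x)\partial^\alpha$ with $C^\infty$ matrix-valued coefficients on $\mathbb R^d$. Here $A: \mathcal E\to\mathcal F$, $B:\mathcal G\to\mathcal H$ with $\mathcal E=C^\infty(\mathbb R^d;\mathbb R^n)$, $\mathcal F=C^\infty(\mathbb R^d;\mathbb R^m)$, $\mathcal G=C^\infty(\mathbb R^d;\mathbb R^p)$, $\mathcal H=C^\infty(\mathbb R^d;\mathbb R^q)$. Such operators also act on (vector-valued) smooth functions and distributions on any open subset of $\mathbb R^d$. $A$ is a silvern differential transmutation of $B$ if there are linear differential operators with $C^\infty$ coefficients $P:\mathcal G\to\mathcal E$, $Q:\mathcal E\to\mathcal G$, $R:\mathcal H\to\mathcal F$, $S:\mathcal F\to\mathcal H$, $T:\mathcal F\to\mathcal E$ such that $AP=RB$, $BQ=SA$ and $PQ+TA=\mathrm{Id}_{\mathcal E}$. A linear differential operator $A$ satisfies the Runge property with point controls on $\mathbb R^d$ if: for any compact $K\subset\mathbb R^d$, any $f$ in the image of $C^\infty(\mathbb R^d)$ by $A$, any integer $k\ge 0$, any $\varepsilon>0$, any set $E$ with exactly one point in each bounded connected component of $\mathbb R^d\setminus K$ (and no other point), and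 any smooth function $u$ defined on an open neighbourhood $\Omega$ of $K$ and satisfying $Au=f$ in $\Omega$, there exists $\overline u$ defined on the whole space $\mathbb R^d$ (a distribution on $\mathbb R^d$ which is a smooth function in a neighbourhood of $K$) such that $A\overline u=f+g$ on $\mathbb R^d$, where $g$ is a finite linear combination (with vector coefficients) of derivatives of Dirac masses located at points of $E$, and $\|\overline u-u\|_{C^k(K)}\le\varepsilon$. Here $\|w\|_{C^k(K)}$ is the maximum over $|\alpha|\le k$ of $\sup_K|\partial^\alpha w|$. *)

(* Defs.v *)
From HB Require Import structures.
From mathcomp Require Import all_boot all_order all_algebra.
From mathcomp Require Import all_classical all_reals all_analysis.

Set Implicit Arguments.
Unset Strict Implicit.
Unset Printing Implicit Defensive.

Import Order.TTheory GRing.Theory Num.Theory.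
Import numFieldNormedType.Exports.

Local Open Scope classical_set_scope.
Local Open Scope ring_scope.

(* R^d is 'rV[R]_d; R^n-valued functions take values in the columns 'cV[R]_n,
   so that matrix coefficients act by left multiplication.  A function defined
   only on an open set is a total function whose values elsewhere are junk. *)

Definition mindex (d : nat) := {ffun 'I_d -> nat}.

Definition mabs (d : nat) (alpha : mindex d) : nat := (\sum_i alpha i)%N.

(* The multi-indices of length at most k have all their entries at most k, so
   sums over |alpha| <= k are taken over this finite type, restricted by mabs. *)
Definition bindex (d k : nat) := {ffun 'I_d -> 'I_k.+1}.

Definition mval (d k : nat) (beta : bindex d k) : mindex d :=
  [ffun i => nat_of_ord (beta i)].

Definition pd (R : realType) (d : nat) (W : normedModType R) (i : 'I_d)
    (f : 'rV[R]_d -> W) : 'rV[R]_d -> W :=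
  fun x => 'D_(delta_mx 0 i) f x.

Definition pdiff (R : realType) (d : nat) (W : normedModType R)
    (alpha : mindex d) (f : 'rV[R]_d -> W) : 'rV[R]_d -> W :=
  foldr (fun i g => iter (alpha i) (pd i) g) f (enum 'I_d).

Fixpoint Ck (R : realType) (d : nat) (W : normedModType R) (k : nat)
    (U : set 'rV[R]_d) (f : 'rV[R]_d -> W) : Prop :=
  (forall x, U x -> {for x, continuous f}) /\
  match k with
  | 0 => True
  | k'.+1 => forall i : 'I_d,
      (forall x, U x -> derivable f x (delta_mx 0 i)) /\ Ck k' U (pd i f)
  end.

(* Only meaningful for U open. *)
Definition smooth (R : realType) (d : nat) (W : normedModType R)
    (U : set 'rV[R]_d) (f : 'rV[R]_d -> W) : Prop :=
  forall k, Ck k U f.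

Definition Ck_norm (R : realType) (d : nat) (W : normedModType R) (k : nat)
    (K : set 'rV[R]_d) (w : 'rV[R]_d -> W) : \bar R :=
  \big[maxe/0%E]_(beta : bindex d k | (mabs (mval beta) <= k)%N)
    ereal_sup [set `|pdiff (mval beta) w x|%:E | x in K].

(* The operator \sum_(|alpha| <= ldo_ord) ldo_coef alpha * d^alpha, from
   C^oo(R^d; R^n) to C^oo(R^d; R^m); the coefficients of multi-indices of
   length larger than ldo_ord play no role. *)
Record ldo (R : realType) (d n m : nat) := Ldo {
  ldo_ord : nat;
  ldo_coef : mindex d -> 'rV[R]_d -> 'M[R]_(m, n);
  ldo_coef_smooth : forall alpha, smooth setT (ldo_coef alpha)
}.

Definition ldo_app (R : realType) (d n m : nat) (L : ldo R d n m)
    (u : 'rV[R]_d -> 'cV[R]_n) : 'rV[R]_d -> 'cV[R]_m :=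
  fun x => \sum_(beta : bindex d (ldo_ord L)
                 | (mabs (mval beta) <= ldo_ord L)%N)
             ldo_coef L (mval beta) x *m pdiff (mval beta) u x.

(* Lebesgue integral over R^d as an iterated integral.  It is only applied to
   continuous functions with compact support, where by Fubini it is the
   integral against the d-dimensional Lebesgue measure. *)
Fixpoint integral_Rd (R : realType) (d : nat) : ('rV[R]_d -> R) -> R :=
  match d return ('rV[R]_d -> R) -> R with
  | 0 => fun f => f 0
  | d'.+1 => fun f =>
      (\int[@lebesgue_measure R]_t
         integral_Rd (fun x : 'rV[R]_d' =>
           f (row_mx (t%:M : 'rV[R]_1) x : 'rV[R]_(1 + d'))))%R
  end.

Definition support_of (R : realType) (d : nat) (phi : 'rV[R]_d -> R) :
    set 'rV[R]_d :=
  closure [set x | phi x != 0].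

Definition test_function (R : realType) (d : nat) (phi : 'rV[R]_d -> R) :
    Prop :=
  smooth setT phi /\ compact (support_of phi).

(* Values of a functional outside the test functions are junk. *)
Definition functional (R : realType) (d : nat) := ('rV[R]_d -> R) -> R.

Definition is_distribution (R : realType) (d : nat) (T : functional R d) :
    Prop :=
  (forall (a : R) (phi psi : 'rV[R]_d -> R),
     test_function phi -> test_function psi ->
     T (fun x => a * phi x + psi x) = a * T phi + T psi) /\
  (forall K : set 'rV[R]_d, compact K ->
     exists (c : R) (k : nat), forall phi : 'rV[R]_d -> R,
       test_function phi -> support_of phi `<=` K ->
       (`|T phi|%:E <= c%:E * Ck_norm k K phi)%E).

Definition dist_of_fun (R : realType) (d : nat) (f : 'rV[R]_d -> R) :
    functional R d :=
  fun phi => integral_Rd (fun x => f x * phi x).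

Definition dist_dirac (R : realType) (d : nat) (a : 'rV[R]_d) :
    functional R d :=
  fun phi => phi a.

Definition dist_pdiff (R : realType) (d : nat) (alpha : mindex d)
    (T : functional R d) : functional R d :=
  fun phi => (-1) ^+ mabs alpha * T (pdiff alpha phi).

Definition dist_mul (R : realType) (d : nat) (c : 'rV[R]_d -> R)
    (T : functional R d) : functional R d :=
  fun phi => T (fun x => c x * phi x).

(* R^n-valued distributions are n-tuples of scalar ones. *)
Definition vfunctional (R : realType) (d n : nat) := 'I_n -> functional R d.

Definition ldo_dist (R : realType) (d n m : nat) (L : ldo R d n m)
    (u : vfunctional R d n) : vfunctional R d m :=
  fun i phi =>
    \sum_(beta : bindex d (ldo_ord L) | (mabs (mval beta) <= ldo_ord L)%N)
      \sum_(j < n)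
        dist_mul (fun x => ldo_coef L (mval beta) x i j)
          (dist_pdiff (mval beta) (u j)) phi.

Definition dist_of_vfun (R : realType) (d n : nat)
    (f : 'rV[R]_d -> 'cV[R]_n) : vfunctional R d n :=
  fun i => dist_of_fun (fun x => f x i 0).

(* A triple (a, alpha, c) stands for c * d^alpha delta_a. *)
Definition dirac_comb (R : realType) (d m : nat)
    (s : seq ('rV[R]_d * mindex d * 'cV[R]_m)) : vfunctional R d m :=
  fun i phi =>
    \sum_(t <- s) t.2 i 0 * dist_pdiff t.1.2 (dist_dirac t.1.1) phi.

Definition eq_vdist (R : realType) (d n : nat) (u v : vfunctional R d n) :
    Prop :=
  forall (i : 'I_n) (phi : 'rV[R]_d -> R), test_function phi ->
    u i phi = v i phi.

Definition eq_vdist_on (R : realType) (d n : nat) (V : set 'rV[R]_d)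
    (u v : vfunctional R d n) : Prop :=
  forall (i : 'I_n) (phi : 'rV[R]_d -> R), test_function phi ->
    support_of phi `<=` V -> u i phi = v i phi.

Definition one_point_per_bounded_component (R : realType) (d : nat)
    (K E : set 'rV[R]_d) : Prop :=
  (forall a, E a ->
     (~` K) a /\ bounded_set (connected_component (~` K) a)) /\
  (forall x, (~` K) x -> bounded_set (connected_component (~` K) x) ->
     exists! a, E a /\ connected_component (~` K) x a).

Definition runge_point_controls (R : realType) (d n m : nat)
    (A : ldo R d n m) : Prop :=
  forall (K : set 'rV[R]_d) (f : 'rV[R]_d -> 'cV[R]_m) (k : nat) (eps : R)
         (E Omega : set 'rV[R]_d) (u : 'rV[R]_d -> 'cV[R]_n),
    compact K ->
    (exists w : 'rV[R]_d -> 'cV[R]_n,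
       smooth setT w /\ (forall x, f x = ldo_app A w x)) ->
    0 < eps ->
    one_point_per_bounded_component K E ->
    open Omega -> K `<=` Omega ->
    smooth Omega u ->
    (forall x, Omega x -> ldo_app A u x = f x) ->
    exists (ubar : vfunctional R d n) (V : set 'rV[R]_d)
           (v : 'rV[R]_d -> 'cV[R]_n)
           (s : seq ('rV[R]_d * mindex d * 'cV[R]_m)),
      [/\ forall j, is_distribution (ubar j),
          [/\ open V, K `<=` V, smooth V v &
              eq_vdist_on V ubar (dist_of_vfun v)],
          (forall t, t \in s -> E t.1.1),
          eq_vdist (ldo_dist A ubar)
            (fun i phi => dist_of_vfun f i phi + dirac_comb s i phi) &
          (Ck_norm k K (fun x => v x - u x)%R <= eps%:E)%E].

Definition silvern_transmutation (R : realType) (d n m p q : nat)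
    (A : ldo R d n m) (B : ldo R d p q) : Prop :=
  exists (P : ldo R d p n) (Q : ldo R d n p) (R' : ldo R d q m)
         (S : ldo R d m q) (T : ldo R d m n),
    [/\ forall g : 'rV[R]_d -> 'cV[R]_p, smooth setT g ->
          forall x, ldo_app A (ldo_app P g) x = ldo_app R' (ldo_app B g) x,
        forall e : 'rV[R]_d -> 'cV[R]_n, smooth setT e ->
          forall x, ldo_app B (ldo_app Q e) x = ldo_app S (ldo_app A e) x &
        forall e : 'rV[R]_d -> 'cV[R]_n, smooth setT e ->
          forall x,
            ldo_app P (ldo_app Q e) x + ldo_app T (ldo_app A e) x = e x].

(* Main.v *)
Require Import Defs.
From mathcomp Require Import all_boot all_order all_algebra.
From mathcomp Require Import all_classical all_reals all_analysis.
From mathcomp Require Import ring lra.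

(* Subtracting from u a global solution w of A w = f, one may take f = 0.  Then
   u0 = u - w satisfies B (Q u0) = S (A u0) = 0 and P (Q u0) = u0 near K, so the
   property of B with zero right-hand side gives vbar close to Q u0 on K with
   B vbar carried by the control points, and w + P vbar is the solution sought:
   A (P vbar) = R' (B vbar) is again a combination of derivatives of Dirac masses.

   The operator identities are only assumed on smooth functions on R^d, but are
   used both on functions that are smooth near K and on distributions.  They are
   transported through formal transposes: integrating by parts against g, the
   identity L1 g = L2 g for all smooth g gives equality of the transposes on test
   functions, which is the identity for distributions, and which, tested against
   bump functions, gives it for functions smooth on an open set. *)

Set Implicit Arguments.
Unset Strict Implicit.
Unset Printing Implicit Defensive.

Import Order.TTheory GRing.Theory Num.Theory.
Import numFieldNormedType.Exports.

Local Open Scope classical_set_scope.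
Local Open Scope ring_scope.

(** * Smooth functions *)

Section CkTheory.
Variables (R : realType) (d : nat).
Local Notation E := 'rV[R]_d.
Implicit Types (U V : set E) (i j : 'I_d).

(** Taking f = 0 removes a term T f that would otherwise have to be added to P vbar. Since P loses
    derivatives, B is asked for closeness in C^(k + order of P), with an accuracy fixed by a
    continuity constant of P on K; that constant has to be known before the approximant is. The
    composites AP, R'B, BQ, SA and PQ + TA are not given by coefficients. Transposes are therefore
    characterised by their integration identity, which is stable under composition and sums, so that
    no composite is ever expanded. That equal operators have equal transposes rests on a positivity
    argument: a test function with zero L^2 norm vanishes. Hence the iterated integral needs
    definiteness on nonnegative functions besides linearity and integration by parts, and each of
    these goes by induction on d through the continuity of slice integrals. *)

Lemma mx_normP (m n : nat) (M : 'M[R]_(m, n)) (c : R) :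
  0 <= c -> reflect (forall a b, `|M a b| <= c) (`|M| <= c).
Proof.
move=> c0; rewrite /Num.Def.normr/= mx_normrE; apply: (iffP idP).
  move=> h a b; apply: le_trans h.
  exact: (le_bigmax _ (fun ab : ('I_m * 'I_n)%type => `|M ab.1 ab.2|) (a, b)).
by move=> h; apply/bigmax_leP; split => // -[a b] _; exact: h.
Qed.

Lemma open_near U x : open U -> U x -> \forall y \near x, U y.
Proof. by move=> oU Ux; apply: open_nbhs_nbhs. Qed.

Section GeneralTarget.
Variable W : normedModType R.
Implicit Types f g : E -> W.

Lemma pd_near i f g x : (\forall y \near x, f y = g y) -> pd i f x = pd i g x.
Proof. exact: near_eq_derive. Qed.

Lemma eq_on_pd i U f g : open U -> (forall x, U x -> f x = g x) ->
  forall x, U x -> pd i f x = pd i g x.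
Proof.
move=> oU fg x Ux; apply: pd_near; near=> y; apply: fg; near: y.
exact: open_near.
Unshelve. all: by end_near. Qed.

Lemma Ck_continuous k U f : Ck k U f -> forall x, U x -> {for x, continuous f}.
Proof. by case: k => [|k] []. Qed.

Lemma eq_on_continuous U f g x : open U -> (forall x, U x -> f x = g x) ->
  U x -> {for x, continuous f} -> {for x, continuous g}.
Proof.
move=> oU fg Ux cf; rewrite /prop_for /continuous_at -(fg x Ux).
have fgx : {near x, f =1 g} by apply: filterS (open_near oU Ux) => y; exact: fg.
exact: cvg_trans (near_eq_cvg fgx) cf.
Qed.

(** Functions on [U] are total with arbitrary values elsewhere; openness of [U] makes partial
    derivatives at its points depend only on the values in [U]. Closure properties are transferred
    through this locality. *)
Lemma Ck_ext k U f g : open U -> (forall x, U x -> f x = g x) ->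
  Ck k U f -> Ck k U g.
Proof.
move=> oU; elim: k f g => [|k ih] f g fg /= [cf df]; split=> //.
- by move=> x Ux; exact: eq_on_continuous oU fg Ux (cf x Ux).
- by move=> x Ux; exact: eq_on_continuous oU fg Ux (cf x Ux).
move=> i; have [dfi Cf] := df i; split.
  move=> x Ux; apply: near_eq_derivable (dfi x Ux); near=> y.
  by apply: fg; near: y; exact: open_near.
by apply: ih Cf; exact: eq_on_pd.
Unshelve. all: by end_near. Qed.

Lemma Ck_sub k U V f : V `<=` U -> Ck k U f -> Ck k V f.
Proof.
move=> VU; elim: k f => [|k ih] f /= [cf df]; split => //; try by move=> x /VU; exact: cf.
move=> i; have [dfi Cf] := df i; split; last exact: ih.
by move=> x /VU; exact: dfi.
Qed.

Lemma CkU k U V f : Ck k U f -> Ck k V f -> Ck k (U `|` V) f.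
Proof.
elim: k f => [|k ih] f /= [cf df] [cf' df']; (split; [by move=> x []; auto|]) => //.
move=> i; have [dfi Cf] := df i; have [dfi' Cf'] := df' i.
by split; [move=> x []; auto|exact: ih].
Qed.

Lemma CkS k U f : Ck k.+1 U f -> Ck k U f.
Proof.
elim: k f => [|k ih] f; first by case.
case=> cf df; split => // i; have [dfi Cf] := df i; split => //.
exact: ih.
Qed.

Lemma CkD k U f g : open U -> Ck k U f -> Ck k U g ->
  Ck k U (fun x => f x + g x).
Proof.
move=> oU; elim: k f g => [|k ih] f g /= [cf df] [cg dg].
  by split => // x Ux; exact: (continuousD (cf x Ux) (cg x Ux)).
split; first by move=> x Ux; exact: (continuousD (cf x Ux) (cg x Ux)).
move=> i; have [dfi Cf] := df i; have [dgi Cg] := dg i; split.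
  by move=> x Ux; apply: derivableD; [exact: dfi|exact: dgi].
apply: Ck_ext (ih _ _ Cf Cg) => // x Ux.
by rewrite /pd -deriveD; [|exact: dfi|exact: dgi].
Qed.

Lemma pd_cst i (c : W) : pd i (fun _ : E => c) = fun=> 0.
Proof. by apply/funext => x; exact: derive_cst. Qed.

Lemma Ck_cst k U (c : W) : Ck k U (fun=> c).
Proof.
elim: k c => [|k ih] c /=; split=> //; try by move=> x _; exact: cst_continuous.
move=> i; split; first by move=> x _; exact: derivable_cst.
by rewrite pd_cst.
Qed.

Lemma smooth_ext U f g : open U -> (forall x, U x -> f x = g x) ->
  smooth U f -> smooth U g.
Proof. by move=> oU fg sf k; exact: Ck_ext (sf k). Qed.

Lemma smooth_sub U V f : V `<=` U -> smooth U f -> smooth V f.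
Proof. by move=> VU sf k; exact: Ck_sub (sf k). Qed.

Lemma smoothU U V f : smooth U f -> smooth V f -> smooth (U `|` V) f.
Proof. by move=> sf sg k; exact: CkU. Qed.

Lemma smooth_pd i U f : smooth U f -> smooth U (pd i f).
Proof. by move=> sf k; have [_ /(_ i)[]] := sf k.+1. Qed.

Lemma smooth_derivable i U f x :
  smooth U f -> U x -> derivable f x (delta_mx 0 i).
Proof. by move=> sf Ux; have [_ /(_ i)[df _]] := sf 1%N; exact: df. Qed.

Lemma smooth_continuous U f x : smooth U f -> U x -> {for x, continuous f}.
Proof. by move=> sf; exact: (Ck_continuous (sf 0%N)). Qed.

Lemma smooth_cst U (c : W) : smooth U (fun=> c).
Proof. by move=> k; exact: Ck_cst. Qed.

Lemma smoothD U f g : open U -> smooth U f -> smooth U g ->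
  smooth U (fun x => f x + g x).
Proof. by move=> oU sf sg k; exact: CkD. Qed.

Lemma smooth_sum (I : Type) (r : seq I) (P : pred I) U (F : I -> E -> W) :
  open U -> (forall t, P t -> smooth U (F t)) ->
  smooth U (fun x => \sum_(t <- r | P t) F t x).
Proof.
move=> oU sF; elim: r => [|t r ih].
  by under eq_fun do rewrite big_nil; exact: smooth_cst.
under eq_fun do rewrite big_cons; case Pt: (P t) => //.
by apply: smoothD => //; exact: sF.
Qed.

End GeneralTarget.

Section Scalar.
Implicit Types f g : E -> R.

Lemma derivable_mul f g x v : derivable f x v -> derivable g x v ->
  derivable (fun y => f y * g y) x v.
Proof. by move=> df dg; have := @derivableM R _ f g x v df dg. Qed.

Lemma derive_mul f g x v : derivable f x v -> derivable g x v ->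
  'D_v (fun y => f y * g y) x = 'D_v f x * g x + f x * 'D_v g x.
Proof.
move=> df dg; have := @deriveM R _ f g x v df dg.
by move=> /= ->; rewrite addrC /GRing.scale/= [g x * _]mulrC.
Qed.

Lemma CkM k U f g : open U -> Ck k U f -> Ck k U g ->
  Ck k U (fun x => f x * g x).
Proof.
move=> oU; elim: k f g => [|k ih] f g Cf Cg.
  by split => // x Ux; exact: (continuousM (Ck_continuous Cf Ux) (Ck_continuous Cg Ux)).
split; first by move=> x Ux; exact: (continuousM (Ck_continuous Cf Ux) (Ck_continuous Cg Ux)).
have [_ df] := Cf; have [_ dg] := Cg.
move=> i; have [dfi Cfi] := df i; have [dgi Cgi] := dg i; split.
  by move=> x Ux; apply: derivable_mul; [exact: dfi|exact: dgi].
apply: (@Ck_ext _ _ _ (fun x => pd i f x * g x + f x * pd i g x)) => //.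
  by move=> x Ux; rewrite /pd derive_mul; [|exact: dfi|exact: dgi].
by apply: CkD => //; apply: ih => //; exact: CkS.
Qed.

Lemma smoothM U f g : open U -> smooth U f -> smooth U g ->
  smooth U (fun x => f x * g x).
Proof. by move=> oU sf sg k; exact: CkM. Qed.

Lemma smooth_scale U (c : R) f : open U -> smooth U f ->
  smooth U (fun x => c * f x).
Proof. by move=> oU sf; apply: smoothM => //; exact: smooth_cst. Qed.

Lemma smooth_prod (I : Type) (r : seq I) (F : I -> E -> R) U :
  open U -> (forall t, smooth U (F t)) ->
  smooth U (fun x => \prod_(t <- r) F t x).
Proof.
move=> oU sF; elim: r => [|t r ih].
  by under eq_fun do rewrite big_nil; exact: smooth_cst.
by under eq_fun do rewrite big_cons; exact: smoothM.
Qed.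

Lemma pdM U f g i x : smooth U f -> smooth U g -> U x ->
  pd i (fun y => f y * g y) x = pd i f x * g x + f x * pd i g x.
Proof.
move=> sf sg Ux; have df := smooth_derivable (i := i) sf Ux.
by have dg := smooth_derivable (i := i) sg Ux; rewrite /pd derive_mul.
Qed.

Lemma pdD U f g i x : smooth U f -> smooth U g -> U x ->
  pd i (fun y => f y + g y) x = pd i f x + pd i g x.
Proof.
move=> sf sg Ux; have df := smooth_derivable (i := i) sf Ux.
by have dg := smooth_derivable (i := i) sg Ux; rewrite /pd -deriveD.
Qed.

End Scalar.

Lemma continuous_mxP (m n : nat) (F : E -> 'M[R]_(m, n)) (x : E) :
  {for x, continuous F} <->
  forall a b, {for x, continuous (fun y => F y a b)}.
Proof.
split=> [cF a b|cF].
  by apply: (@continuous_comp _ _ _ F (fun M : 'M[R]_(m, n) => M a b)) => //;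
    exact: coord_continuous.
apply/(@cvgrPdist_le _ _ _ (nbhs x)) => e e0.
have near_ab (ab : 'I_m * 'I_n) :
    \forall y \near x, `|F x ab.1 ab.2 - F y ab.1 ab.2| <= e.
  by move/cvgrPdist_le : (cF ab.1 ab.2) => /(_ e e0).
have near_le (y : E) : (forall ab : 'I_m * 'I_n, `|F x ab.1 ab.2 - F y ab.1 ab.2| <= e) ->
    `|F x - F y| <= e.
  move=> Fy; apply/mx_normP; first exact: ltW.
  by move=> a b; rewrite !mxE; exact: (Fy (a, b)).
exact: (@filterS _ (nbhs x) _ _ _ near_le (filter_forall _ near_ab)).
Qed.

Lemma pd_mx (m n : nat) (F : E -> 'M[R]_(m, n)) i x a b :
  derivable F x (delta_mx 0 i) -> pd i F x a b = pd i (fun y => F y a b) x.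
Proof. by move=> dF; rewrite /pd derive_mx// mxE. Qed.

Lemma Ck_mxP k U (m n : nat) (F : E -> 'M[R]_(m, n)) : open U ->
  Ck k U F <-> forall a b, Ck k U (fun y => F y a b).
Proof.
move=> oU; elim: k F => [|k ih] F.
  split=> [[cF _] a b|cF]; split=> // x Ux.
    by have /continuous_mxP := cF x Ux; exact.
  by apply/continuous_mxP => a b; have [+ _] := cF a b; exact.
split=> [[cF dF] a b|cF]; split.
- by move=> x Ux; have /continuous_mxP := cF x Ux; exact.
- move=> i; have [dFi /ih CF] := dF i; split.
    by move=> x Ux; have /derivable_mxP := dFi x Ux; exact.
  by apply: Ck_ext (CF a b) => // x Ux; rewrite pd_mx //; exact: dFi.
- by move=> x Ux; apply/continuous_mxP => a b; have [+ _] := cF a b; exact.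
- move=> i.
  have dFi x : U x -> derivable F x (delta_mx 0 i).
    move=> Ux; apply/derivable_mxP => a b.
    by have [_ /(_ i)[dF _]] := cF a b; exact: dF.
  split => //; apply/ih => a b.
  have [_ /(_ i)[_ CF]] := cF a b; apply: Ck_ext CF => // x Ux.
  by rewrite pd_mx //; exact: dFi.
Qed.

Lemma smooth_mxP U (m n : nat) (F : E -> 'M[R]_(m, n)) : open U ->
  smooth U F <-> forall a b, smooth U (fun y => F y a b).
Proof.
move=> oU; split=> [sF a b k|sF k]; first exact: (Ck_mxP k F oU).1.
by apply/Ck_mxP => // a b; exact: sF.
Qed.

End CkTheory.

(** * Iterated partial derivatives *)

Section Words.
Variables (R : realType) (d : nat).
Local Notation E := 'rV[R]_d.
Implicit Types (U : set E) (f g : E -> R) (i j : 'I_d) (w : seq 'I_d).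
Local Notation e_ i := (delta_mx 0 i : 'rV[R]_d).

Lemma norm_delta_le1 i : `|e_ i| <= 1.
Proof.
apply/mx_normP => // a b; rewrite mxE.
by case: (_ && _); rewrite ?normr1 ?normr0 ?ler01.
Qed.

Lemma is_derive_line f (y v : E) (s : R) : derivable f (y + s *: v) v ->
  is_derive s (1 : R) (fun t => f (y + t *: v)) ('D_v f (y + s *: v)).
Proof.
move=> df.
(* Both difference quotients are the same function of [h], so derivability and the value of the
   derivative transfer together. *)
have eqq : (fun h : R => h^-1 *: (((fun t => f (y + t *: v)) \o shift s) (h *: (1 : R)) -
      f (y + s *: v))) =
    (fun h => h^-1 *: ((f \o shift (y + s *: v)) (h *: v) - f (y + s *: v))).
  apply/funext => h /=; congr (_ *: (f _ - _)).
  by rewrite (_ : h *: (1 : R) = h) ?scalerDl 1?addrCA//; exact: mulr1.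
by apply: DeriveDef; rewrite /derivable /derive eqq.
Qed.

Lemma derivable_translate f (a x v : E) : derivable f (x + a) v ->
  derivable (fun y => f (y + a)) x v /\
  'D_v (fun y => f (y + a)) x = 'D_v f (x + a).
Proof.
have eqq : (fun h : R => h^-1 *: (((fun y => f (y + a)) \o shift x) (h *: v) -
      f (x + a))) =
    (fun h => h^-1 *: ((f \o shift (x + a)) (h *: v) - f (x + a))).
  by apply/funext => h /=; rewrite addrA.
by move=> df; rewrite /derivable /derive eqq.
Qed.

Lemma MVT_line f (y v : E) (h : R) : 0 < h ->
  (forall t, 0 <= t <= h -> derivable f (y + t *: v) v) ->
  exists2 c, 0 <= c <= h & f (y + h *: v) - f y = h * 'D_v f (y + c *: v).
Proof.
move=> h0 df.
have dline t : 0 <= t <= h ->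
    is_derive t (1 : R) (fun t => f (y + t *: v)) ('D_v f (y + t *: v)).
  by move=> /df; exact: is_derive_line.
have [| |c /[!in_itv]/= /andP[c0 ch]] := @MVT R (fun t => f (y + t *: v))
    (fun t => 'D_v f (y + t *: v)) 0 h h0.
- by move=> t /[!in_itv]/= /andP[t0 th]; apply: dline; rewrite !ltW.
- apply: derivable_within_continuous => t /[!in_itv]/= th.
  by have [] := dline t th.
- rewrite scale0r addr0 subr0 => ->; exists c; last by rewrite mulrC.
  by rewrite !ltW.
Qed.

(** Two mean value theorems in succession: along [e_ i] for the increment [f (y + h *: e_ j) - f y],
    then along [e_ j] for [pd i f]. Exchanging [i] and [j] gives the other mixed derivative at
    another point for the same second difference. *)
Lemma second_difference U f (x : E) i j (h : R) : 0 < h -> smooth U f ->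
  (forall y, `|y - x| <= 2 * h -> U y) ->
  exists2 p, `|p - x| <= 2 * h &
    f (x + h *: e_ i + h *: e_ j) - f (x + h *: e_ i) - (f (x + h *: e_ j) - f x) =
    h * (h * pd j (pd i f) p).
Proof.
move=> h0 sf xU.
have close s t : 0 <= s <= h -> 0 <= t <= h ->
    `|x + s *: e_ i + t *: e_ j - x| <= 2 * h.
  move=> /andP[s0 sh] /andP[t0 th].
  rewrite -(addrA x) (addrC x) addrK (le_trans (ler_normD _ _))// mulr2n mulrDl mul1r.
  by apply: lerD; rewrite mx_normZ ger0_norm// -[leRHS]mulr1 ler_pM// norm_delta_le1.
have h00 : (0 : R) <= 0 <= h by rewrite lexx ltW.
have hh : (0 : R) <= h <= h by rewrite lexx ltW.
pose g y := f (y + h *: e_ j) - f y.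
have dg s : 0 <= s <= h -> derivable g (x + s *: e_ i) (e_ i) /\
    'D_(e_ i) g (x + s *: e_ i) =
    pd i f (x + s *: e_ i + h *: e_ j) - pd i f (x + s *: e_ i).
  move=> sh.
  have d1 : derivable f (x + s *: e_ i + h *: e_ j) (e_ i).
    by apply: smooth_derivable sf _; apply: xU; exact: close.
  have d2 : derivable f (x + s *: e_ i) (e_ i).
    apply: smooth_derivable sf _; apply: xU.
    by have := close s 0 sh h00; rewrite scale0r addr0.
  have [d3 e3] := derivable_translate d1.
  split; first exact: derivableB d3 d2.
  by rewrite /pd -e3; exact: deriveB d3 d2.
have [s sh gE] := MVT_line h0 (fun s sh => (dg s sh).1).
have [t' th'|t th tE] := @MVT_line (pd i f) (x + s *: e_ i) (e_ j) h h0.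
  apply: (smooth_derivable (i := j) (smooth_pd i sf)).
  by apply: xU; exact: close.
exists (x + s *: e_ i + t *: e_ j); first exact: close.
by rewrite -tE -(dg s sh).2 -gE.
Qed.

Lemma nbhs_norm_ball (x : E) (A : set E) : nbhs x A ->
  exists2 r : R, 0 < r & forall y : E, `|y - x| < r -> A y.
Proof.
move=> /nbhs_ballP[r /= r0 rA]; exists r => // y yx; apply: rA.
by rewrite -ball_normE /ball_ /= distrC.
Qed.

Lemma continuous_norm_ball f (x : E) (e : R) : {for x, continuous f} -> 0 < e ->
  exists2 r : R, 0 < r & forall y : E, `|y - x| < r -> `|f x - f y| < e.
Proof.
move=> cf e0; apply: nbhs_norm_ball.
by apply: (proj1 (@cvgrPdist_lt _ _ _ (nbhs x) _ _ _)) e0; exact: cf.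
Qed.

(** Schwarz's theorem. The second difference is symmetric in [i] and [j], so the two mixed
    derivatives agree at points [p] and [q] arbitrarily close to [x], and continuity concludes. *)
Lemma pd_comm U f i j (x : E) : open U -> smooth U f -> U x ->
  pd i (pd j f) x = pd j (pd i f) x.
Proof.
move=> oU sf Ux; apply/eqP; rewrite -subr_eq0 -normr_le0; apply/ler_addgt0Pl => e e0.
rewrite addr0.
have e20 : 0 < e / 2 by rewrite divr_gt0.
have cij : {for x, continuous (pd i (pd j f))}.
  exact: smooth_continuous (smooth_pd _ (smooth_pd _ sf)) Ux.
have cji : {for x, continuous (pd j (pd i f))}.
  exact: smooth_continuous (smooth_pd _ (smooth_pd _ sf)) Ux.
have [r1 r10 h1] := continuous_norm_ball cij e20.
have [r2 r20 h2] := continuous_norm_ball cji e20.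
have [r3 r30 h3] := nbhs_norm_ball (open_near oU Ux).
pose r := Num.min r1 (Num.min r2 r3).
have r0 : 0 < r by rewrite !lt_min r10 r20.
(* The points [p] and [q] lie within [2 * h] of [x]; this choice keeps them strictly inside the
   radius [r], where both continuity estimates and membership in [U] hold. *)
pose h := r / 4.
have h0 : 0 < h by rewrite divr_gt0.
have h2r : 2 * h < r by rewrite /h; lra.
have hU y : `|y - x| <= 2 * h -> U y.
  by move=> yx; apply: h3; apply: le_lt_trans yx _; apply: lt_le_trans h2r _;
    rewrite !ge_min lexx !orbT.
have [p px pE] := second_difference j i h0 sf hU.
have [q qx qE] := second_difference i j h0 sf hU.
have pq : pd i (pd j f) p = pd j (pd i f) q.
  apply: (mulfI (lt0r_neq0 h0)); apply: (mulfI (lt0r_neq0 h0)).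
  apply: etrans (esym pE) (etrans _ qE); rewrite (addrAC x).
  generalize (f (x + h *: e_ i + h *: e_ j)) (f (x + h *: e_ i)) (f (x + h *: e_ j)) (f x).
  by move=> a b c u; ring.
have /ltW hp : `|pd i (pd j f) x - pd i (pd j f) p| < e / 2.
  apply: h1; apply: le_lt_trans px _; apply: lt_le_trans h2r _.
  by rewrite ge_min lexx.
have /ltW hq : `|pd j (pd i f) x - pd j (pd i f) q| < e / 2.
  apply: h2; apply: le_lt_trans qx _; apply: lt_le_trans h2r _.
  by rewrite !ge_min lexx orbT.
move: pq hp hq; generalize (pd i (pd j f) x) (pd j (pd i f) x).
generalize (pd i (pd j f) p) (pd j (pd i f) q) => a b u v -> ua vb.
by rewrite (le_trans (ler_distD b _ _))// (splitr e) lerD// distrC.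
Qed.

(** Words of directions replace multi-indices: composition is concatenation, and induction peels off
    one derivative at a time. The order of the letters matters until [perm_dw]. *)
Definition dw (W : normedModType R) w (f : E -> W) : E -> W := foldr (@pd R d W) f w.

Lemma dw_cat (W : normedModType R) w1 w2 (f : E -> W) : dw (w1 ++ w2) f = dw w1 (dw w2 f).
Proof. exact: foldr_cat. Qed.

Lemma smooth_dw (W : normedModType R) U w (f : E -> W) : smooth U f -> smooth U (dw w f).
Proof. by move=> sf; elim: w => //= i w; exact: smooth_pd. Qed.

Lemma eq_on_dw (W : normedModType R) U w (f g : E -> W) : open U -> (forall x, U x -> f x = g x) ->
  forall x, U x -> dw w f x = dw w g x.
Proof. by move=> oU fg; elim: w => //= i w; exact: eq_on_pd. Qed.

Lemma dwD U w f g (x : E) : open U -> smooth U f -> smooth U g -> U x ->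
  dw w (fun y => f y + g y) x = dw w f x + dw w g x.
Proof.
move=> oU sf sg; elim: w x => //= i w ih x Ux.
by rewrite (eq_on_pd _ oU ih Ux) (pdD (U := U))//; exact: smooth_dw.
Qed.

Lemma dwZ U w c f (x : E) : open U -> smooth U f -> U x ->
  dw w (fun y => c * f y) x = c * dw w f x.
Proof.
move=> oU sf; elim: w x => //= i w ih x Ux.
rewrite (eq_on_pd _ oU ih Ux) (pdM (U := U))//; last exact: smooth_dw.
  by rewrite pd_cst mul0r add0r.
exact: smooth_cst.
Qed.

(** Leibniz's rule without binomial coefficients: each letter goes to one of the two factors, which
    gives [2 ^ size w] terms with repetitions. *)
Fixpoint splits w : seq (seq 'I_d * seq 'I_d) :=
  if w is i :: w' then
    [seq (i :: t.1, t.2) | t <- splits w'] ++ [seq (t.1, i :: t.2) | t <- splits w']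
  else [:: ([::], [::])].

Lemma size_splits w t : t \in splits w -> (size t.1 + size t.2 = size w)%N.
Proof.
elim: w t => [|i w ih] t /=; first by rewrite inE => /eqP ->.
by rewrite mem_cat => /orP[] /mapP[s /ih <- ->] //=; rewrite addnS.
Qed.

Lemma leibniz U w f g (x : E) : open U -> smooth U f -> smooth U g -> U x ->
  dw w (fun y => f y * g y) x = \sum_(t <- splits w) dw t.1 f x * dw t.2 g x.
Proof.
move=> oU sf sg; elim: w x => [|i w ih] x Ux /=; first by rewrite big_seq1.
rewrite (eq_on_pd _ oU ih Ux) big_cat !big_map /= -big_split /=.
elim: (splits w) => [|t s ihs].
  by under eq_fun do rewrite big_nil; rewrite big_nil pd_cst.
under eq_fun do rewrite big_cons; rewrite big_cons -ihs.
rewrite (pdD (U := U)) ?(pdM (U := U))//; try exact: smooth_dw.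
  by apply: smoothM => //; exact: smooth_dw.
by apply: smooth_sum => // u _; apply: smoothM => //; exact: smooth_dw.
Qed.

Lemma dw_pd_comm U w i f (x : E) : open U -> smooth U f -> U x ->
  dw w (pd i f) x = pd i (dw w f) x.
Proof.
move=> oU sf; elim: w x => //= j w ih x Ux.
rewrite (eq_on_pd _ oU ih Ux).
exact: (pd_comm j i oU (smooth_dw w sf) Ux).
Qed.

Lemma dw_comm U w1 w2 f (x : E) : open U -> smooth U f -> U x ->
  dw w1 (dw w2 f) x = dw w2 (dw w1 f) x.
Proof.
move=> oU sf; elim: w1 x => //= i w ih x Ux.
rewrite (eq_on_pd _ oU ih Ux).
exact: (esym (dw_pd_comm w2 i oU (smooth_dw w sf) Ux)).
Qed.

Lemma perm_dw U w1 w2 f : open U -> smooth U f -> perm_eq w1 w2 ->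
  forall x : E, U x -> dw w1 f x = dw w2 f x.
Proof.
move=> oU sf w12 x Ux; apply/esym.
(* Permutations are generated by exchanges of two adjacent blocks at the front, so commuting two
   blocks by [dw_comm] is enough. *)
apply: (@catCA_perm_ind _ (fun w => dw w f x = dw w1 f x) _ _ _ w12) => [s1 s2 s3 <-|//].
by rewrite !dw_cat; exact: (dw_comm s2 s1 oU (smooth_dw s3 sf) Ux).
Qed.

(** The letters come in the order in which [pdiff] nests its derivatives, so [pdiffE] holds for
    every function, smooth or not. *)
Definition mword (alpha : mindex d) : seq 'I_d :=
  flatten [seq nseq (alpha i) i | i <- enum 'I_d].

Definition wcount w : mindex d := [ffun i => count_mem i w].

Lemma pdiffE (W : normedModType R) alpha (f : E -> W) : pdiff alpha f = dw (mword alpha) f.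
Proof.
rewrite /pdiff /mword; elim: (enum 'I_d) => //= i s ->.
by rewrite dw_cat; elim: (alpha i) => //= k ->.
Qed.

Lemma count_mword alpha i : count_mem i (mword alpha) = alpha i.
Proof.
rewrite /mword count_flatten -map_comp sumnE big_map big_enum /=.
rewrite (bigD1 i)//= count_nseq /= eqxx mul1n big1 ?addn0// => j ji.
by rewrite count_nseq /= (negbTE ji).
Qed.

Lemma size_mword alpha : size (mword alpha) = mabs alpha.
Proof.
rewrite /mword size_flatten /shape -map_comp sumnE big_map big_enum /=.
by apply: eq_bigr => i _ /=; rewrite size_nseq.
Qed.

Lemma perm_mword w : perm_eq (mword (wcount w)) w.
Proof. by apply/allP => i _ /=; rewrite count_mword ffunE. Qed.

Lemma mabs_wcount w : mabs (wcount w) = size w.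
Proof. by rewrite -size_mword; apply: perm_size; exact: perm_mword. Qed.

Lemma dw_pdiff U w f (x : E) : open U -> smooth U f -> U x ->
  dw w f x = pdiff (wcount w) f x.
Proof.
by move=> oU sf Ux; rewrite pdiffE; apply: (perm_dw oU sf _ Ux); rewrite perm_sym perm_mword.
Qed.

Lemma bindexP k (alpha : mindex d) : (mabs alpha <= k)%N ->
  exists beta : bindex d k, mval beta = alpha.
Proof.
move=> ak; exists [ffun i => inord (alpha i)]; apply/ffunP => i.
rewrite !ffunE inordK// ltnS (leq_trans _ ak)//.
by rewrite /mabs (bigD1 i)//= leq_addr.
Qed.

End Words.

(** * The iterated integral *)

Section OneDim.
Variable R : realType.
Local Notation mu := (@lebesgue_measure R).
Implicit Types (F G : R -> R) (M c : R).

Definition Cc1 M F := continuous F /\ forall t, M < `|t| -> F t = 0.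

Lemma Cc1_itv M F : Cc1 M F -> F = F \_ `[- M, M].
Proof.
move=> [_ F0]; apply/funext => t; rewrite patchE; case: ifPn => //.
rewrite notin_setE /= in_itv /= => /negP; rewrite negb_and -!ltNge => tM.
by apply: F0; rewrite lter_normr; case/orP: tM => ?; apply/orP; [right; lra|left].
Qed.

Lemma Cc1_Rintegral M F : Cc1 M F ->
  \int[mu]_t F t = \int[mu]_(t in `[- M, M]) F t.
Proof. by move=> FM; rewrite [RHS]Rintegral_mkcond -(Cc1_itv FM). Qed.

Lemma continuous_integrable_itv F a b : continuous F ->
  mu.-integrable `[a, b] (EFin \o F).
Proof.
move=> cF; apply: continuous_compact_integrable; first exact: segment_compact.
exact: continuous_subspaceT.
Qed.

Lemma Cc1_integrable M F : Cc1 M F -> mu.-integrable setT (EFin \o F).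
Proof.
move=> FM; rewrite (Cc1_itv FM) -restrict_EFin -integrable_mkcond//.
by apply: continuous_integrable_itv; case: FM.
Qed.

Lemma Cc1_linear M a F G : Cc1 M F -> Cc1 M G ->
  \int[mu]_t (a * F t + G t) = a * \int[mu]_t F t + \int[mu]_t G t.
Proof.
move=> FM GM; have iF := Cc1_integrable FM; have iG := Cc1_integrable GM.
rewrite RintegralD//; first by rewrite RintegralZl.
by have := integrableZl measurableT a iF.
Qed.

Lemma Cc1_bound M c F : 0 < M -> Cc1 M F -> (forall t, `|F t| <= c) ->
  `|\int[mu]_t F t| <= 2 * M * c.
Proof.
move=> M0 FM Fc; rewrite (Cc1_Rintegral FM).
have iF : mu.-integrable `[- M, M] (EFin \o F).
  by apply: continuous_integrable_itv; case: FM.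
apply: (le_trans (le_normr_Rintegral _ iF)) => //.
have -> : 2 * M * c = \int[mu]_(t in `[- M, M]) c.
  rewrite Rintegral_cst//= lebesgue_measure_itv/= lte_fin.
  by rewrite gtrN// -EFinB /= mulrC; ring.
apply: le_Rintegral => //; first exact: (integrable_norm iF).
by apply: continuous_integrable_itv => t; exact: cvg_cst.
Qed.

Lemma Cc1_derive M F : 0 < M -> Cc1 M F -> (forall t, derivable F t 1) ->
  continuous (fun t => 'D_1 F t) -> \int[mu]_t 'D_1 F t = 0.
Proof.
move=> M0 [cF F0] dF cF'.
(* The vanishing of [F] is known only for [M < |t|], strictly; the radius [M + 1] puts the end
   points of the segment there. *)
have F'M : Cc1 (M + 1) (fun t => 'D_1 F t).
  split=> // t tM; rewrite (@near_eq_derive _ _ _ F (cst 0)) ?derive_cst//.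
  have tM' : \forall s \near t, M < `|s|.
    by apply: (cvgr_gt _ (@norm_continuous _ R t)); lra.
  by apply: filterS tM' => s; exact: F0.
rewrite (Cc1_Rintegral F'M) /Rintegral.
rewrite (@continuous_FTC2 _ _ F); first last.
- by move=> t _; rewrite derive1E.
- split.
  + by move=> t _; exact: dF.
  + by apply: cvg_at_right_filter; exact: cF.
  + by apply: cvg_at_left_filter; exact: cF.
- exact: continuous_subspaceT.
- lra.
by rewrite !F0 ?subee// ?normrN ger0_norm; lra.
Qed.

Lemma Cc1_ge0_eq0 M F : Cc1 M F -> (forall t, 0 <= F t) ->
  \int[mu]_t F t = 0 -> forall t, F t = 0.
Proof.
move=> FM F0 iF0 t0; apply/eqP; rewrite eq_le F0 andbT leNgt; apply/negP => Ft0.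
have [cF _] := FM.
have : \forall t \near t0, F t0 / 2 < F t.
  by apply: (cvgr_gt _ (cF t0)); lra.
move=> /nbhs_ballP[r /= r0 rF].
(* The closed segment of half-length [r / 2] stays in the ball where [F] exceeds [F t0 / 2]; its
   length is [r], so the integral is at least [r * (F t0 / 2) > 0]. *)
have : \int[mu]_(t in `[t0 - r / 2, t0 + r / 2]) (F t0 / 2) <= \int[mu]_t F t.
  rewrite Rintegral_mkcond; apply: le_Rintegral => //.
  - rewrite -restrict_EFin -integrable_mkcond//.
    by apply: continuous_integrable_itv => t; exact: cvg_cst.
  - exact: Cc1_integrable FM.
  move=> t _; rewrite patchE; case: ifPn => // /set_mem.
  rewrite /= in_itv/= => /andP[tl tr]; apply/ltW/rF.
  by rewrite /ball/= distrC ltr_norml; apply/andP; split; lra.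
rewrite iF0 Rintegral_cst//= lebesgue_measure_itv/= lte_fin ifT; last by lra.
rewrite -EFinB /= leNgt => /negP; apply.
by apply: mulr_gt0; lra.
Qed.

End OneDim.

(** * Slicing R^(d+1) as R x R^d *)

Section Slices.
Variables (R : realType) (d : nat).
Implicit Types (t s : R) (x y : 'rV[R]_d).

(** The same [row_mx] expression as in [integral_Rd], read through the conversion of [1 + d] to
    [d.+1], so that [integral_RdS] holds by computation. *)
Definition slice t x : 'rV[R]_d.+1 := row_mx (t%:M : 'rV[R]_1) x : 'rV[R]_(1 + d).

Lemma slice0 t x : slice t x ord0 ord0 = t.
Proof.
have -> : slice t x ord0 ord0 = row_mx (t%:M : 'rV[R]_1) x ord0 (lshift d (ord0 : 'I_1)).
  by congr (fun_of_matrix _ _ _); exact: val_inj.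
by rewrite row_mxEl mxE eqxx.
Qed.

Lemma slice_lift t x (j : 'I_d) : slice t x ord0 (lift ord0 j) = x ord0 j.
Proof.
apply: (@etrans _ _ (row_mx (t%:M : 'rV[R]_1) x ord0 (rshift 1 j))); last by rewrite row_mxEr.
by congr (fun_of_matrix _ _ _); exact: val_inj.
Qed.

Lemma row_ord_ind (z z' : 'rV[R]_d.+1) : z ord0 ord0 = z' ord0 ord0 ->
  (forall k, z ord0 (lift ord0 k) = z' ord0 (lift ord0 k)) -> z = z'.
Proof.
by move=> h0 hS; apply/rowP => j; case: (unliftP ord0 j) => [k ->|->]; [exact: hS|].
Qed.

Lemma sliceB t s x y : slice t x - slice s y = slice (t - s) (x - y).
Proof.
apply: row_ord_ind => [|k]; first by rewrite !(slice0, mxE).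
by rewrite !(slice_lift, mxE).
Qed.

Lemma sliceDZ t x (h : R) s y : slice t x + h *: slice s y = slice (t + h * s) (x + h *: y).
Proof.
apply: row_ord_ind => [|k]; first by rewrite !(slice0, mxE).
by rewrite !(slice_lift, mxE).
Qed.

Lemma slice_delta0 : slice 1 0 = delta_mx 0 ord0.
Proof.
apply: row_ord_ind => [|k].
by rewrite slice0 mxE !eqxx.
by rewrite slice_lift !mxE eqxx /=.
Qed.

Lemma slice_delta (i : 'I_d) : slice 0 (delta_mx 0 i) = delta_mx 0 (lift ord0 i).
Proof.
apply: row_ord_ind => [|k].
by rewrite slice0 mxE eqxx.
by rewrite slice_lift !mxE !eqxx /= (inj_eq lift_inj).
Qed.

Lemma slice_surj (z : 'rV[R]_d.+1) : exists t x, z = slice t x.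
Proof.
exists (z ord0 ord0), (\row_j z ord0 (lift ord0 j)); apply: row_ord_ind => [|k].
by rewrite slice0.
by rewrite slice_lift mxE.
Qed.

Lemma slice_norm_le t x (c : R) : `|slice t x| <= c <-> `|t| <= c /\ `|x| <= c.
Proof.
split=> [h|[ht hx]].
  have c0 := le_trans (normr_ge0 _) h.
  have /(mx_normP _ c0) hc := h.
  split; first by rewrite -(slice0 t x).
  by apply/mx_normP => // a b; rewrite ord1 -(slice_lift t x).
have c0 := le_trans (normr_ge0 _) ht.
apply/mx_normP => // a j; rewrite ord1.
case: (unliftP ord0 j) => [k ->|->]; last by rewrite slice0.
by rewrite slice_lift; have /(mx_normP _ c0) := hx; exact.
Qed.

End Slices.

(** An explicit radius instead of mere compactness of the support: for the maximum norm every slice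
    keeps the same [M], which makes the estimates uniform in the slice. *)
Definition Cc (R : realType) (d : nat) (M : R) (f : 'rV[R]_d -> R) :=
  continuous f /\ forall x, M < `|x| -> f x = 0.

(** * Linearity, bounds and definiteness of the iterated integral *)

Section IntegralRd.
Variable R : realType.
Local Notation mu := (@lebesgue_measure R).
Implicit Types (M a c : R).

Lemma CcD d M a (f g : 'rV[R]_d -> R) : Cc M f -> Cc M g -> Cc M (fun x => a * f x + g x).
Proof.
move=> [cf f0] [cg g0]; split=> [x|x xM]; last by rewrite f0// g0// mulr0 addr0.
have ca : {for x, continuous (fun _ : 'rV[R]_d => a)} by exact: cst_continuous.
exact: (continuousD (continuousM ca (cf x)) (cg x)).
Qed.

Lemma continuous_slice d (f : 'rV[R]_d.+1 -> R) (t : R) (x : 'rV[R]_d) (e : R) : 0 < e ->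
  continuous f -> exists2 r, 0 < r & forall s y, `|s - t| < r -> `|y - x| < r ->
    `|f (slice t x) - f (slice s y)| < e.
Proof.
move=> e0 cf; have [r r0 rf] := continuous_norm_ball (cf (slice t x)) e0.
exists r => // s y st yx; apply: rf; rewrite sliceB.
rewrite (@le_lt_trans _ _ (Num.max `|s - t| `|y - x|))//; last by rewrite gt_max st.
by apply/slice_norm_le; rewrite !le_max !lexx orbT.
Qed.

Lemma slice_Cc d M (f : 'rV[R]_d.+1 -> R) t : Cc M f -> Cc M (fun x => f (slice t x)).
Proof.
move=> [cf f0]; split=> [x|x xM].
  apply/(@cvgrPdist_lt _ _ _ (nbhs x)) => e e0.
  have [r r0 rf] := continuous_slice t x e0 cf.
  apply/nbhs_ballP; exists r => //= y; rewrite -ball_normE /ball_/= distrC => xy.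
  by apply: rf => //; rewrite subrr normr0.
apply: f0; rewrite ltNge; apply/negP => /slice_norm_le[_].
by rewrite leNgt xM.
Qed.

(** Linearity and boundedness in dimension [d] are named because they travel together through the
    induction: jointly they make slice integrals continuous in the first coordinate, which the
    one-dimensional lemmas need in dimension [d.+1]. *)
Definition integral_linear d := forall M a (f g : 'rV[R]_d -> R), 0 < M ->
  Cc M f -> Cc M g ->
  integral_Rd (fun x => a * f x + g x) = a * integral_Rd f + integral_Rd g.

Definition integral_bounded d := forall M, 0 < M ->
  exists2 C, 0 < C & forall c (f : 'rV[R]_d -> R), Cc M f ->
    (forall x, `|f x| <= c) -> `|integral_Rd f| <= C * c.

(* Uniform convergence on the common compact support, via the covering form of compactness. *)
Lemma integral_cvg d M (I : Type) (F : set_system I) (FF : Filter F)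
    (g : I -> 'rV[R]_d -> R) (g0 : 'rV[R]_d -> R) :
  integral_linear d -> integral_bounded d -> 0 < M -> Cc M g0 -> (forall i, Cc M (g i)) ->
  (forall e : R, 0 < e -> forall x : 'rV[R]_d, \forall y \near x & i \near F, `|g i y - g0 y| <= e) ->
  integral_Rd (g i) @[i --> F] --> integral_Rd g0.
Proof.
move=> lin bnd M0 g0M gM gg0; have [C C0 hC] := bnd _ M0.
apply/cvgrPdist_le => e e0.
have e'0 : 0 < e / C by rewrite divr_gt0.
have cK : compact [set x : 'rV[R]_d | `|x| <= M].
  apply: bounded_closed_compact.
    by exists M; split; [exact: num_real|move=> N MN x /= xM; exact: le_trans xM (ltW MN)].
  apply: (@closed_comp _ _ (fun x : 'rV[R]_d => `|x|) [set r | r <= M]); last exact: closed_le.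
  by move=> x _; exact: norm_continuous.
have := (compact_near_coveringP _).1 cK _ F (fun i y => `|g i y - g0 y| <= e / C) FF.
move=> /(_ (fun x _ => gg0 _ e'0 x)); apply: filterS => i hi.
have h1 : Cc M (fun x => -1 * g i x + g0 x) by exact: CcD.
rewrite addrC -mulN1r -(lin M)//.
have -> : e = C * (e / C) by rewrite mulrC divfK// gt_eqF.
apply: hC => // x; rewrite mulN1r addrC distrC.
have [xM|xM] := leP `|x| M; first exact: hi.
by rewrite (g0M.2 x xM) ((gM i).2 x xM) subrr normr0 ltW.
Qed.

Lemma integral_slice_Cc1 d M (f : 'rV[R]_d.+1 -> R) :
  integral_linear d -> integral_bounded d -> 0 < M -> Cc M f ->
  Cc1 M (fun t => integral_Rd (fun x => f (slice t x))).
Proof.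
move=> lin bnd M0 fM; split=> [t|t tM].
  apply: (@integral_cvg d M R (nbhs t) _ (fun s x => f (slice s x))) => //.
  - exact: slice_Cc.
  - by move=> s; exact: slice_Cc.
  move=> e e0 x; have e20 : 0 < e / 2 by rewrite divr_gt0.
  have [r r0 rf] := continuous_slice t x e20 fM.1.
  exists ((ball x r), (ball t r)); first by split; exact: nbhsx_ballx.
  move=> [y s] /= []; rewrite -!ball_normE /ball_/= (distrC x) (distrC t) => yx st.
  have /ltW h1 := rf s y st yx.
  have /ltW h2 : `|f (slice t x) - f (slice t y)| < e / 2.
    by apply: rf => //; rewrite subrr normr0.
  rewrite (le_trans (ler_distD (f (slice t x)) _ _))// (splitr e) lerD//.
  by rewrite distrC.
(* Zero is written as [-1 * 0 + 0] so that linearity alone evaluates its integral: [- I + I = 0]. *)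
rewrite (_ : (fun x => _) = fun x => -1 * 0 + 0); last first.
  apply/funext => x; rewrite mulr0 addr0; apply: fM.2.
  by rewrite ltNge; apply/negP => /slice_norm_le[]; rewrite leNgt tM.
have Cc0 : Cc M (fun _ : 'rV[R]_d => 0) by split=> // x; exact: cst_continuous.
by rewrite (lin M)// mulN1r addNr.
Qed.

Lemma integral_RdS d (f : 'rV[R]_d.+1 -> R) :
  integral_Rd f = \int[mu]_t integral_Rd (fun x => f (slice t x)).
Proof. by []. Qed.

(** Each dimension contributes a factor [2 * M], the length of the segment carrying the function, so
    the constant is [(2 * M) ^+ d]. *)
Lemma integral_Rd_props d : integral_linear d /\ integral_bounded d.
Proof.
elim: d => [|d [lin bnd]].
  split=> [M a f g M0 _ _ //|M M0]; exists 1 => // c f _ fc.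
  by rewrite mul1r; exact: fc.
split=> [M a f g M0 fM gM|M M0].
  rewrite !integral_RdS -(Cc1_linear _ (integral_slice_Cc1 lin bnd M0 fM) (integral_slice_Cc1 lin bnd M0 gM)).
  congr (Rintegral _ _ _); apply/funext => t.
  by rewrite -(lin M)//; exact: slice_Cc.
have [C C0 hC] := bnd M M0; exists (2 * M * C); first by rewrite !mulr_gt0.
move=> c f fM fc; rewrite integral_RdS -(mulrA _ C c).
apply: (Cc1_bound M0 (integral_slice_Cc1 lin bnd M0 fM)).
by move=> t; apply: hC => //; exact: slice_Cc.
Qed.

Lemma integral_Rd_linear d M a (f g : 'rV[R]_d -> R) : 0 < M -> Cc M f -> Cc M g ->
  integral_Rd (fun x => a * f x + g x) = a * integral_Rd f + integral_Rd g.
Proof. by have [lin _] := integral_Rd_props d; exact: lin. Qed.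

Lemma integral_Rd_bound d M : 0 < M ->
  exists2 C, 0 < C & forall c (f : 'rV[R]_d -> R), Cc M f ->
    (forall x, `|f x| <= c) -> `|integral_Rd f| <= C * c.
Proof. by have [_] := integral_Rd_props d; exact. Qed.

Lemma integral_Rd_ge0 d (f : 'rV[R]_d -> R) : (forall x, 0 <= f x) -> 0 <= integral_Rd f.
Proof.
elim: d f => [|d ih] f f0; first exact: f0.
by rewrite integral_RdS; apply: Rintegral_ge0 => t _; apply: ih.
Qed.

(** The slice integrals form a continuous nonnegative function of [t] with zero integral, so each of
    them vanishes, and the induction hypothesis applies to every slice. *)
Lemma integral_Rd_eq0 d M (f : 'rV[R]_d -> R) : 0 < M -> Cc M f -> (forall x, 0 <= f x) ->
  integral_Rd f = 0 -> forall x, f x = 0.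
Proof.
move=> M0; elim: d f => [|d ih] f fM f0 If0 x.
  by rewrite (_ : x = 0)//; apply/rowP => -[].
have [lin bnd] := integral_Rd_props d.
have sl0 := Cc1_ge0_eq0 (integral_slice_Cc1 lin bnd M0 fM)
  (fun t => integral_Rd_ge0 (fun x => f0 (slice t x))) If0.
have [t [y ->]] := slice_surj x.
by apply: (ih (fun y => f (slice t y))) => //; exact: slice_Cc.
Qed.

End IntegralRd.

(** * The integral of a partial derivative vanishes *)

Section Parts.
Variable R : realType.
Local Notation mu := (@lebesgue_measure R).

Lemma MVT_line_signed d (f : 'rV[R]_d -> R) (y v : 'rV[R]_d) (h : R) : h != 0 ->
  (forall t, derivable f (y + t *: v) v) ->
  exists2 c, `|c| <= `|h| & h^-1 * (f (y + h *: v) - f y) = 'D_v f (y + c *: v).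
Proof.
move=> hn0 df; case: (ltgtP h 0) hn0 => [h0 _|h0 _|//].
(* For negative [h] the segment is run from [y + h *: v] to [y]; both signs are needed for a
   two-sided limit of difference quotients. *)
- have nh0 : 0 < - h by rewrite oppr_gt0.
  have [|c /andP[c0 ch]] := @MVT_line R d f (y + h *: v) v _ nh0.
    by move=> t _; rewrite -addrA -scalerDl; exact: df.
  rewrite -!addrA -!scalerDl subrr scale0r addr0 => e; exists (h + c).
    by rewrite !ler0_norm; lra.
  by rewrite -opprB e -mulNr opprK mulrA mulVf ?mul1r// lt_eqF.
- have [|c /andP[c0 ch] e] := @MVT_line R d f y v _ h0; first by move=> t _; exact: df.
  exists c; first by rewrite !ger0_norm; lra.
  by rewrite e mulrA mulVf ?mul1r// gt_eqF.
Qed.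

Lemma Cc_pd d M (f : 'rV[R]_d -> R) i : Cc M f -> continuous (pd i f) -> Cc M (pd i f).
Proof.
move=> [cf f0] cf'; split=> // x xM; rewrite (@pd_near _ _ _ i f (fun=> 0)) ?pd_cst//.
have xM' : \forall y \near x, M < `|y|.
  by apply: (cvgr_gt _ (@norm_continuous _ _ x)).
by apply: filterS xM' => y; exact: f0.
Qed.

Lemma derive_slice d (f : 'rV[R]_d.+1 -> R) t k (x : 'rV[R]_d) :
  derivable f (slice t x) (delta_mx 0 (lift ord0 k)) ->
  derivable (fun x => f (slice t x)) x (delta_mx 0 k) /\
  pd k (fun x => f (slice t x)) x = pd (lift ord0 k) f (slice t x).
Proof.
have eqq : (fun h : R => h^-1 *: (((fun x => f (slice t x)) \o shift x) (h *: delta_mx 0 k) -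
      f (slice t x))) =
    (fun h => h^-1 *: ((f \o shift (slice t x)) (h *: delta_mx 0 (lift ord0 k)) - f (slice t x))).
  apply/funext => h /=; congr (_ *: (f _ - _)).
  by rewrite -slice_delta addrC [RHS]addrC sliceDZ mulr0 addr0.
by move=> df; rewrite /pd /derivable /derive eqq.
Qed.

(** Differentiation under the integral sign: by the mean value theorem the difference quotient at
    [y] is a value of [pd ord0 f] on a nearby slice, so continuity of that derivative gives the
    local uniform convergence that [integral_cvg] asks for. *)
Lemma derive_integral_slice d M (f : 'rV[R]_d.+1 -> R) t : 0 < M -> Cc M f ->
  (forall x, derivable f x (delta_mx 0 ord0)) -> continuous (pd ord0 f) ->
  is_derive t (1 : R) (fun t => integral_Rd (fun x => f (slice t x)))
    (integral_Rd (fun x => pd ord0 f (slice t x))).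
Proof.
move=> M0 fM df cf'; set F := fun t => _.
have [lin bnd] := integral_Rd_props R d.
(* The quotient is put in the shape [a * f + g] expected by linearity. At [h = 0] the inverse is 0,
   so [g 0] vanishes and [gM] holds without a case distinction. *)
pose g (h : R) x := - h^-1 * f (slice t x) + h^-1 * f (slice (h + t) x).
have gM h : Cc M (g h).
  rewrite /g; apply: CcD; first exact: slice_Cc.
  rewrite (_ : (fun x => _) = fun x => h^-1 * f (slice (h + t) x) + 0 * f (slice t x)).
    apply: CcD; first exact: slice_Cc.
    rewrite (_ : (fun x => _) = fun x => -1 * f (slice t x) + f (slice t x)).
      by apply: CcD; exact: slice_Cc.
    by apply/funext => x; rewrite mul0r mulN1r addNr.
  by apply/funext => x; rewrite mul0r addr0.
have eqq : (fun h : R => h^-1 *: ((F \o shift t) (h *: (1 : R)) - F t)) =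
    fun h => integral_Rd (g h).
  apply/funext => h /=; rewrite (_ : h *: (1 : R) = h); last exact: mulr1.
  have h1 := slice_Cc (h + t) fM.
  have h2 := slice_Cc t fM.
  have h0 : Cc M (fun x : 'rV[R]_d => 0).
    by split=> // x; exact: cst_continuous.
  have I0 : integral_Rd (fun x : 'rV[R]_d => 0 : R) = 0.
    have := lin M 1 _ _ M0 h0 h0; rewrite (_ : (fun x => 1 * 0 + 0) = fun=> 0).
      by rewrite mul1r => /eqP; rewrite addrC -subr_eq subrr eq_sym => /eqP.
    by apply/funext => x; rewrite mulr0 addr0.
  have h3 : Cc M (fun x => h^-1 * f (slice (h + t) x)).
    rewrite (_ : (fun x => _) = fun x => h^-1 * f (slice (h + t) x) + 0); first exact: CcD.
    by apply/funext => x; rewrite addr0.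
  have I3 : integral_Rd (fun x => h^-1 * f (slice (h + t) x)) = h^-1 * F (h + t).
    rewrite (_ : (fun x => _) = fun x => h^-1 * f (slice (h + t) x) + 0).
      by rewrite (lin M)// I0 addr0.
    by apply/funext => x; rewrite addr0.
  rewrite /g (lin M)// I3 -/(F t) mulNr [RHS]addrC.
  exact: mulrBr.
have f'M : Cc M (pd ord0 f) by exact: Cc_pd.
suff cvgF : integral_Rd (g h) @[h --> (0 : R)^'] -->
    integral_Rd (fun x => pd ord0 f (slice t x)).
  apply: DeriveDef; rewrite /derivable /derive eqq.
    by apply/cvg_ex; eexists; exact: cvgF.
  exact: cvg_lim.
apply: (@integral_cvg R d M R (0 : R)^' _ g _ lin bnd M0) => //.
  exact: slice_Cc.
move=> e e0 x; have e20 : 0 < e / 2 by rewrite divr_gt0.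
have [r r0 rf] := continuous_slice t x e20 cf'.
exists ((ball x r), [set h : R | h != 0 /\ `|h| < r]).
  split; first exact: nbhsx_ballx.
  have n1 : \forall h \near (0 : R)^', h != 0 by exact: nbhs_dnbhs_neq.
  have n2 : \forall h \near (0 : R)^', `|h| < r by exact: dnbhs0_lt.
  by apply: filterS2 n1 n2 => h; split.
move=> [y h] /= []; rewrite -!ball_normE /ball_/= (distrC x) => yx [hn0 hr].
have [|c ch ce] := @MVT_line_signed _ f (slice t y) (slice 1 0) h hn0.
  by move=> s; rewrite slice_delta0; exact: df.
have -> : g h y = pd ord0 f (slice (t + c) y).
  rewrite /pd -slice_delta0 -(addr0 y) -[in RHS](scaler0 _ c) -[X in X + c]addr0.
  have := ce; rewrite !sliceDZ !scaler0 !mulr1 !addr0 => <-.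
  by rewrite /g mulrBr mulNr addrC (addrC t).
have /ltW p1 : `|pd ord0 f (slice t x) - pd ord0 f (slice (t + c) y)| < e / 2.
  by apply: rf => //; rewrite addrC addKr (le_lt_trans ch).
have /ltW p2 : `|pd ord0 f (slice t x) - pd ord0 f (slice t y)| < e / 2.
  by apply: rf => //; rewrite subrr normr0.
rewrite (le_trans (ler_distD (pd ord0 f (slice t x)) _ _))// (splitr e) lerD//.
by rewrite distrC.
Qed.

(** A derivative in a later coordinate already integrates to zero on every slice, by induction. In
    the first coordinate it is the derivative of the slice integral, a function of [t] that vanishes
    for large [|t|], and the fundamental theorem applies. *)
Lemma integral_pd d M (f : 'rV[R]_d -> R) i : 0 < M -> Cc M f ->
  (forall x, derivable f x (delta_mx 0 i)) -> continuous (pd i f) ->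
  integral_Rd (pd i f) = 0.
Proof.
move=> M0; elim: d f i => [f []//|d ih] f i fM df cf'.
rewrite integral_RdS.
case: (unliftP ord0 i) => [k ik|i0].
  have eqq t : (fun x => pd i f (slice t x)) = pd k (fun x => f (slice t x)).
    apply/funext => x; rewrite (derive_slice _).2 ?ik//.
    by rewrite -ik; exact: df.
  under eq_Rintegral => t _.
    rewrite eqq ih; first over.
    - exact: slice_Cc.
    - by move=> x; apply: (derive_slice _).1; rewrite -ik; exact: df.
    - by rewrite -eqq; exact: (slice_Cc t (Cc_pd fM cf')).1.
  by rewrite Rintegral_cst// mul0r.
rewrite i0 in df cf' *.
have [lin bnd] := integral_Rd_props R d.
have dF t := derive_integral_slice t M0 fM df cf'.
have eqq : (fun t => integral_Rd (fun x => pd ord0 f (slice t x))) =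
    fun t : R => 'D_1 (fun t => integral_Rd (fun x => f (slice t x))) t.
  by apply/funext => t; have [_ ->] := dF t.
rewrite eqq; apply: (Cc1_derive M0 (integral_slice_Cc1 lin bnd M0 fM)).
  by move=> t; have [] := dF t.
rewrite -eqq; exact: (integral_slice_Cc1 lin bnd M0 (Cc_pd fM cf')).1.
Qed.

End Parts.

(** * Test functions *)

Section TestFunctions.
Variables (R : realType) (d : nat).
Local Notation E := 'rV[R]_d.
Implicit Types (U : set E) (f g phi psi : E -> R) (i : 'I_d) (w : seq 'I_d).

Lemma notin_support phi (x : E) : ~ support_of phi x -> phi x = 0.
Proof.
move=> xS; apply/eqP; apply: contrapT => /negP phix; apply: xS.
exact: subset_closure.
Qed.

Lemma support_sub phi psi : (forall x, ~ support_of phi x -> psi x = 0) ->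
  support_of psi `<=` support_of phi.
Proof.
move=> h; rewrite [X in _ `<=` X](closure_id _).1; last exact: closed_closure.
apply: closureS => x /= psix; apply: contrapT => /h psi0.
by rewrite psi0 eqxx in psix.
Qed.

Lemma open_setC_support phi : open (~` support_of phi).
Proof. by apply: closed_openC; exact: closed_closure. Qed.

Lemma test_of_support phi psi : test_function phi -> smooth setT psi ->
  (forall x, ~ support_of phi x -> psi x = 0) -> test_function psi.
Proof.
move=> [_ cphi] spsi /support_sub h; split => //.
by apply: subclosed_compact cphi h; exact: closed_closure.
Qed.

Lemma dw_notin_support w phi (x : E) : ~ support_of phi x -> dw w phi x = 0.
Proof.
move=> xS.
have -> : dw w phi x = dw w (fun=> 0) x.
  exact: (eq_on_dw w (open_setC_support (phi := phi)) (@notin_support phi) xS).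
elim: w x {xS} => //= i w ih x.
have -> : dw w (fun _ : E => 0 : R) = fun=> 0 by apply/funext.
by rewrite pd_cst.
Qed.

Lemma support_dw w phi : support_of (dw w phi) `<=` support_of phi.
Proof. by apply: support_sub => x; exact: dw_notin_support. Qed.

Lemma test_dw w phi : test_function phi -> test_function (dw w phi).
Proof.
move=> tphi; apply: (test_of_support tphi).
  by apply: smooth_dw; case: tphi.
by move=> x; exact: dw_notin_support.
Qed.

Lemma support_mul g phi : support_of (fun x => g x * phi x) `<=` support_of phi.
Proof. by apply: support_sub => x /notin_support ->; rewrite mulr0. Qed.

Lemma test_mul_on U g phi : open U -> smooth U g -> test_function phi ->
  support_of phi `<=` U -> test_function (fun x => g x * phi x).
Proof.
move=> oU sg tphi phiU; apply: (test_of_support tphi); last first.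
  by move=> x /notin_support ->; rewrite mulr0.
have -> : [set: E] = U `|` ~` support_of phi.
  by apply/esym/seteqP; split => // x _; case: (pselect (support_of phi x)) => [/phiU|]; [left|right].
apply: smoothU.
  by apply: smoothM => //; apply: smooth_sub tphi.1.
apply: (@smooth_ext _ _ _ _ (fun=> 0)); [exact: open_setC_support| |exact: smooth_cst].
by move=> x /notin_support ->; rewrite mulr0.
Qed.

Lemma test_mul g phi : smooth setT g -> test_function phi ->
  test_function (fun x => g x * phi x).
Proof. by move=> sg tphi; apply: (@test_mul_on setT) => //; exact: openT. Qed.

Lemma test_lin (a : R) phi psi : test_function phi -> test_function psi ->
  test_function (fun x => a * phi x + psi x).
Proof.
move=> [sphi cphi] [spsi cpsi]; split.
  by apply: smoothD (smooth_scale _ openT sphi) spsi; exact: openT.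
apply: (@subclosed_compact _ _ (support_of phi `|` support_of psi)).
- exact: closed_closure.
- exact: compactU.
rewrite -closureU; apply: closureS => x /=.
apply: contraNP => /not_orP[/negP/negPn/eqP -> /negP/negPn/eqP ->].
by rewrite mulr0 addr0.
Qed.

Lemma test0 : test_function (fun _ : E => 0 : R).
Proof.
split; first exact: smooth_cst.
rewrite /support_of (_ : [set x | _] = set0) ?closure0; first exact: compact0.
by apply/seteqP; split => x //=; rewrite eqxx.
Qed.

Lemma test_scale (a : R) phi : test_function phi -> test_function (fun x => a * phi x).
Proof. by apply: test_mul; exact: smooth_cst. Qed.

Lemma testD phi psi : test_function phi -> test_function psi ->
  test_function (fun x => phi x + psi x).
Proof.
move=> tphi tpsi; have := test_lin 1 tphi tpsi.
by under eq_fun do rewrite mul1r.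
Qed.

Lemma test_sum (I : Type) (r : seq I) (P : pred I) (F : I -> E -> R) :
  (forall t, P t -> test_function (F t)) ->
  test_function (fun x => \sum_(t <- r | P t) F t x).
Proof.
move=> tF; elim: r => [|t r ih].
  by under eq_fun do rewrite big_nil; exact: test0.
under eq_fun do rewrite big_cons; case Pt: (P t) => //.
by apply: testD => //; exact: tF.
Qed.

Lemma Cc_le (M M' : R) f : M <= M' -> Cc M f -> Cc M' f.
Proof. by move=> MM [cf f0]; split=> // x xM; apply: f0; exact: le_lt_trans xM. Qed.

Lemma test_continuous phi : test_function phi -> continuous phi.
Proof. by move=> [sphi _] x; exact: smooth_continuous sphi _. Qed.

Lemma test_Cc phi : test_function phi -> exists2 M, 0 < M & Cc M phi.
Proof.
move=> tphi; have /compact_bounded/pinfty_ex_gt0[M M0 hM] := tphi.2.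
exists M => //; split; first exact: test_continuous.
move=> x xM; apply: notin_support => /hM /=.
by rewrite leNgt xM.
Qed.

Lemma test_Cc2 phi psi : test_function phi -> test_function psi ->
  exists M, [/\ 0 < M, Cc M phi & Cc M psi].
Proof.
move=> /test_Cc[M M0 hM] /test_Cc[M' M'0 hM'].
exists (Num.max M M'); split; first by rewrite lt_max M0.
  by apply: Cc_le hM; rewrite le_max lexx.
by apply: Cc_le hM'; rewrite le_max lexx orbT.
Qed.

Lemma integral_test_lin (a : R) phi psi : test_function phi -> test_function psi ->
  integral_Rd (fun x => a * phi x + psi x) = a * integral_Rd phi + integral_Rd psi.
Proof.
by move=> tphi /(test_Cc2 tphi)[M [M0 hphi hpsi]]; exact: integral_Rd_linear M0 _ _.
Qed.

Lemma integral_testD phi psi : test_function phi -> test_function psi ->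
  integral_Rd (fun x => phi x + psi x) = integral_Rd phi + integral_Rd psi.
Proof.
move=> tphi tpsi; rewrite -[in RHS](mul1r (integral_Rd phi)) -integral_test_lin//.
by under [in RHS]eq_fun do rewrite mul1r.
Qed.

Lemma integral_test0 : integral_Rd (fun _ : E => 0 : R) = 0.
Proof.
have := integral_testD test0 test0; under eq_fun do rewrite addr0.
by move/eqP; rewrite -subr_eq subrr eq_sym => /eqP.
Qed.

Lemma integral_testZ (a : R) phi : test_function phi ->
  integral_Rd (fun x => a * phi x) = a * integral_Rd phi.
Proof.
move=> tphi; have := integral_test_lin a tphi test0.
rewrite integral_test0 addr0 => <-.
by under [in RHS]eq_fun do rewrite addr0.
Qed.

Lemma integral_test_sum (I : Type) (r : seq I) (P : pred I) (F : I -> E -> R) :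
  (forall t, P t -> test_function (F t)) ->
  integral_Rd (fun x => \sum_(t <- r | P t) F t x) = \sum_(t <- r | P t) integral_Rd (F t).
Proof.
move=> tF; elim: r => [|t r ih].
  by under eq_fun do rewrite big_nil; rewrite big_nil integral_test0.
under eq_fun do rewrite big_cons; rewrite big_cons; case Pt: (P t) => //.
by rewrite integral_testD ?ih//; [exact: tF|exact: test_sum].
Qed.

Lemma integral_test_pd phi i : test_function phi -> integral_Rd (pd i phi) = 0.
Proof.
move=> tphi; have [M M0 hM] := test_Cc tphi.
apply: integral_pd M0 hM _ _.
  by move=> x; exact: smooth_derivable tphi.1 _.
exact: (test_continuous (test_dw [:: i] tphi)).
Qed.

Lemma integral_sqr_eq0 phi : test_function phi ->
  integral_Rd (fun x => phi x * phi x) = 0 -> forall x, phi x = 0.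
Proof.
move=> tphi I0 x; have [M M0 hM] := test_Cc (test_mul tphi.1 tphi).
have /eqP := integral_Rd_eq0 M0 hM (fun x => sqr_ge0 (phi x)) I0 x.
by rewrite mulf_eq0 orbb => /eqP.
Qed.

Lemma integral_by_parts U g phi i : open U -> smooth U g -> test_function phi ->
  support_of phi `<=` U ->
  integral_Rd (fun x => pd i g x * phi x) = - integral_Rd (fun x => g x * pd i phi x).
Proof.
move=> oU sg tphi phiU.
have t1 : test_function (fun x => pd i g x * phi x).
  by apply: test_mul_on oU (smooth_pd i sg) tphi phiU.
have t2 : test_function (fun x => g x * pd i phi x).
  apply: test_mul_on oU sg (test_dw [:: i] tphi) _.
  exact: subset_trans (@support_dw [:: i] phi) phiU.
apply/eqP; rewrite -addr_eq0 -integral_testD// -(integral_test_pd i (test_mul_on oU sg tphi phiU)).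
apply/eqP; congr integral_Rd; apply/funext => x.
have [xS|xS] := pselect (support_of phi x).
  rewrite (pdM (U := U))//; last exact: phiU.
  by apply: smooth_sub tphi.1.
have := @dw_notin_support [:: i] _ _ xS => /= ->.
rewrite (notin_support xS) !mulr0 addr0.
have xS' : ~ support_of (fun y => g y * phi y) x by move=> /support_mul.
by have := @dw_notin_support [:: i] _ _ xS' => /= ->.
Qed.

Lemma integral_by_parts_dw U g phi w : open U -> smooth U g -> test_function phi ->
  support_of phi `<=` U ->
  integral_Rd (fun x => dw w g x * phi x) =
  (-1) ^+ size w * integral_Rd (fun x => g x * dw w phi x).
Proof.
move=> oU sg + phiU; have : support_of phi `<=` U by [].
elim: w phi phiU => [|i w ih] phi phiU _ tphi; first by rewrite expr0 mul1r.
rewrite [LHS](integral_by_parts i oU (smooth_dw w sg) tphi phiU).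
have phiU' : support_of (pd i phi) `<=` U.
  exact: subset_trans (@support_dw [:: i] phi) phiU.
rewrite ih//; last exact: (test_dw [:: i] tphi).
rewrite exprS mulN1r mulNr; congr (- (_ * integral_Rd _)).
apply/funext => x; congr (_ * _).
(* Integrating by parts letter by letter reverses the word: the leading [i] must be commuted past
   [w]. *)
exact: (dw_pd_comm w i openT tphi.1).
Qed.

End TestFunctions.

(** * Bump functions *)

Section FlatFunction.
Variable R : realType.
Implicit Types (s : R) (n : nat).

(** For [n = 0] the classical flat function exp(-1/s). The powers of 1/s are included so that
    derivatives are linear combinations of members of the family, and smoothness follows by
    induction for all [n] at once. *)
Definition flat n s : R := if 0 < s then s^-1 ^+ n * expR (- s^-1) else 0.

Lemma flat_gt0 n s : 0 < s -> 0 < flat n s.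
Proof. by move=> s0; rewrite /flat s0 mulr_gt0 ?expR_gt0// exprn_gt0// invr_gt0. Qed.

Lemma flat_le0 n s : s <= 0 -> flat n s = 0.
Proof. by move=> s0; rewrite /flat ltNge s0. Qed.

(** With y = 1/s, the exponential dominates y^(n+1)/(n+1)!; taking one power more than [n] leaves
    the factor [|s|] that forces the limit 0 at the origin. *)
Lemma flat_bound n s : `|flat n s| <= n.+1`!%:R * `|s|.
Proof.
have [s0|s0] := leP s 0.
  by rewrite flat_le0// normr0 mulr_ge0.
rewrite ger0_norm; last exact: ltW (flat_gt0 n s0).
rewrite (ger0_norm (ltW s0)) /flat s0 expRN.
have y0 : 0 < s^-1 by rewrite invr_gt0.
rewrite ler_pdivrMr ?expR_gt0//.
have f0 : 0 < n.+1`!%:R :> R by rewrite ltr0n fact_gt0.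
have h : s^-1 ^+ n.+1 / n.+1`!%:R <= expR s^-1.
  by apply: le_trans (expR_ge1Dxn n (ltW y0)); rewrite lerDr.
rewrite ler_pdivrMr// in h.
rewrite -(ler_pM2l y0) -exprS (le_trans h)// mulrC.
by rewrite -mulrA [leRHS]mulrCA mulKf// gt_eqF.
Qed.

Lemma is_derive_flat n s :
  is_derive s (1 : R) (flat n) (flat n.+2 s - n%:R * flat n.+1 s).
Proof.
have [s0|s0|->] := ltrgt0P s.
- have sn0 : s != 0 by rewrite gt_eqF.
  have dV : is_derive s (1 : R) (fun u : R => u^-1) (- s ^- 2).
    have h := @is_deriveV R id s 1 1 sn0 (is_derive_id s 1).
    by apply: is_derive_eq h _; exact: mulr1.
  have dX := is_deriveX n dV.
  have dE := @is_derive1_comp R expR (fun u => - u^-1) s _ _ (is_derive_expR (- s^-1)) (is_deriveN dV).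
  have dM := is_deriveM dX dE.
  have D : is_derive s (1 : R) (fun u => u^-1 ^+ n * expR (- u^-1))
      (flat n.+2 s - n%:R * flat n.+1 s).
    have -> : (fun u : R => u^-1 ^+ n * expR (- u^-1)) =
        (fun u => u^-1) ^+ n * (expR \o (fun u : R => - u^-1)).
      by apply/funext => u; rewrite exprfctE.
    apply: is_derive_eq dM _; rewrite /flat s0 -exprVn /= exprfctE.
    apply: (@etrans _ _ (s^-1 ^+ n * (expR (- s^-1) * - - s^-1 ^+ 2) +
        expR (- s^-1) * (n%:R * s^-1 ^+ n.-1 * - s^-1 ^+ 2))) => //.
    move: (s^-1) (expR _) => y e; case: (n) => [|k /=]; first by ring.
    by rewrite !exprS; ring.
  have H : \forall u \near s, 0 < u.
    exact: (@cvgr_gt R _ (nbhs s) _ id s (@cvg_id _ _) 0 s0).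
  have H' u : 0 < u -> u^-1 ^+ n * expR (- u^-1) = flat n u by rewrite /flat => ->.
  have N : \forall u \near s, u^-1 ^+ n * expR (- u^-1) = flat n u by exact: (filterS H' H).
  exact: (near_eq_is_derive N D).
- rewrite !flat_le0 ?ltW// mulr0 subrr.
  have H : \forall u \near s, u < 0.
    exact: (@cvgr_lt R _ (nbhs s) _ id s (@cvg_id _ _) 0 s0).
  have H' u : u < 0 -> cst 0 u = flat n u by move=> u0; rewrite flat_le0// ltW.
  exact: (near_eq_is_derive (filterS H' H) (is_derive_cst (0 : R) s 1)).
rewrite !flat_le0// mulr0 subrr.
(* At the origin the difference quotient of [flat n] is exactly [flat n.+1], so the derivative is
   the limit of the latter, which [flat_bound] shows to be 0. *)
have eqq : (fun h : R => h^-1 *: ((flat n \o shift 0) (h *: (1 : R)) - flat n 0)) = flat n.+1.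
  apply/funext => h /=; rewrite (flat_le0 n (lexx 0)) subr0 addr0 (_ : h *: (1 : R) = h); last exact: mulr1.
  have [h0|h0] := leP h 0; first by rewrite !flat_le0// scaler0.
  by rewrite /flat h0 exprS -mulrA.
have c0 : flat n.+1 h @[h --> (0 : R)^'] --> (0 : R).
  apply/cvgrPdist_le => e e0.
  have C0 : 0 < n.+2`!%:R :> R by rewrite ltr0n fact_gt0.
  have H : \forall h \near (0 : R)^', `|h| < e / n.+2`!%:R.
    by apply: dnbhs0_lt; rewrite divr_gt0.
  have H' (h : R) : `|h| < e / n.+2`!%:R -> `|0 - flat n.+1 h| <= e.
    rewrite ltr_pdivlMr// => /ltW he; rewrite sub0r normrN.
    by apply: le_trans (flat_bound _ _) _; rewrite mulrC.
  exact: (@filterS _ _ _ _ _ H' H).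
apply: DeriveDef; rewrite /derivable /derive eqq; last exact: cvg_lim.
by apply/cvg_ex; exists 0.
Qed.

End FlatFunction.

(** * Bump functions as products of flat functions of the coordinates *)

Section Bump.
Variables (R : realType) (d : nat).
Local Notation E := 'rV[R]_d.
Implicit Types (c b : R) (i j : 'I_d) (n : nat).

Definition flat_coord n c b j : E -> R := fun x => flat n (c * x 0 j + b).

Lemma is_derive_flat_coord n c b j i (x : E) :
  is_derive x (delta_mx 0 i) (flat_coord n c b j)
    (c * (j == i)%:R * (flat_coord n.+2 c b j x - n%:R * flat_coord n.+1 c b j x)).
Proof.
set k := c * (j == i)%:R; set l := c * x 0 j + b.
have dl : is_derive (0 : R) (1 : R) (fun t : R => l + t * k) k.
  have h := is_deriveD (is_derive_cst l (0 : R) 1)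
    (is_deriveM (is_derive_id (0 : R) 1) (is_derive_cst k (0 : R) 1)).
  apply: is_derive_eq h _.
  by rewrite scaler0 !add0r; exact: mulr1.
have df : is_derive (l + 0 * k) (1 : R) (flat n) (flat n.+2 l - n%:R * flat n.+1 l).
  by rewrite mul0r addr0; exact: is_derive_flat.
have [dg eg] := @is_derive1_comp R _ (fun t : R => l + t * k) 0 _ _ df dl.
have eqq : (fun h : R => h^-1 *: ((flat_coord n c b j \o shift x) (h *: delta_mx 0 i) -
      flat_coord n c b j x)) =
    (fun h : R => h^-1 *: (((flat n \o (fun t : R => l + t * k)) \o shift 0) (h *: (1 : R)) -
      (flat n \o (fun t : R => l + t * k)) 0)).
  apply/funext => h; rewrite /flat_coord /= (_ : h *: (1 : R) = h); last exact: mulr1.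
  rewrite mul0r !addr0 !mxE eqxx /= /k /l; congr (_ *: (flat n _ - _)); ring.
by apply: DeriveDef; rewrite /derivable /derive eqq // [RHS]mulrC.
Qed.

Lemma smooth_flat_coord n c b j : smooth setT (flat_coord n c b j).
Proof.
move=> k; elim: k n => [|k ih] n.
  split => // x _; apply: (@continuous_comp _ _ _ (fun x : E => c * x 0 j + b) (flat n)).
    apply: (@continuousD _ _ _ (fun x : E => c * x 0 j) (fun=> b)); last exact: cst_continuous.
    apply: (@continuousM _ _ (fun=> c) (fun x : E => x 0 j)); first exact: cst_continuous.
    exact: coord_continuous.
  apply/differentiable_continuous/derivable1_diffP.
  by have [] := is_derive_flat n (c * x 0 j + b).
split; first exact: Ck_continuous (ih n).
move=> i; split.
  by move=> x _; have [] := is_derive_flat_coord n c b j i x.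
rewrite (_ : pd i _ = fun x => c * (j == i)%:R *
    (flat_coord n.+2 c b j x + (- n%:R) * flat_coord n.+1 c b j x)).
  apply: CkM; [exact: openT|exact: Ck_cst|].
  apply: CkD; [exact: openT|exact: ih|].
  by apply: CkM; [exact: openT|exact: Ck_cst|exact: ih].
apply/funext => x; rewrite mulNr.
by have [_] := is_derive_flat_coord n c b j i x.
Qed.

Lemma exists_bump (U : set E) (a : E) : open U -> U a ->
  exists chi : E -> R, [/\ test_function chi, support_of chi `<=` U & chi a != 0].
Proof.
move=> oU Ua; have [r r0 rU] := nbhs_norm_ball (open_near oU Ua).
pose r' := r / 2; have r'0 : 0 < r' by rewrite divr_gt0.
(* The two factors for [j] are nonzero exactly when [x 0 j] lies within [r'] of [a 0 j], so [chi]
   lives on a cube, a ball of the maximum norm. Halving [r] keeps its closure in [U]. *)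
pose chi (x : E) := \prod_j (flat_coord 0 1 (r' - a 0 j) j x *
  flat_coord 0 (-1) (r' + a 0 j) j x).
have chi_ball x : chi x != 0 -> `|x - a| <= r'.
  move=> chix; apply/mx_normP; first exact: ltW.
  move=> k j; rewrite ord1 !mxE.
  have : flat_coord 0 1 (r' - a 0 j) j x * flat_coord 0 (-1) (r' + a 0 j) j x != 0.
    by apply: contraNN chix => /eqP h; rewrite /chi (bigD1 j)//= h mul0r.
  rewrite mulf_eq0 negb_or => /andP[h1 h2].
  have g1 : 0 < 1 * x 0 j + (r' - a 0 j).
    by rewrite ltNge; apply: contraNN h1 => h; rewrite /flat_coord flat_le0.
  have g2 : 0 < -1 * x 0 j + (r' + a 0 j).
    by rewrite ltNge; apply: contraNN h2 => h; rewrite /flat_coord flat_le0.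
  by rewrite ler_norml; apply/andP; split; lra.
have supp_ball : support_of chi `<=` [set x | `|x - a| <= r'].
  rewrite [X in _ `<=` X](closure_id _).1; first exact: closureS.
  apply: (@closed_comp _ _ (fun x : E => `|x - a|) [set s | s <= r']); last exact: closed_le.
  move=> x _; apply: (@continuous_comp _ _ _ (fun x : E => x - a) (fun y : E => `|y|)).
    apply: (@continuousD _ _ _ (fun x : E => x) (fun=> - a)); last exact: cst_continuous.
    exact: cvg_id.
  exact: norm_continuous.
exists chi; split.
- split.
    apply: smooth_prod; first exact: openT.
    by move=> j; apply: smoothM; [exact: openT|exact: smooth_flat_coord|exact: smooth_flat_coord].
  apply: bounded_closed_compact; last exact: closed_closure.
  exists (r' + `|a|); split; first exact: num_real.
  move=> N MN x /supp_ball /= xa; rewrite -(subrK a x).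
  by rewrite (le_trans (ler_normD _ _))// (le_trans _ (ltW MN))// lerD2r.
- move=> x /supp_ball /= xa; apply: rU; apply: le_lt_trans xa _.
  by rewrite /r'; lra.
apply/prodf_neq0 => j _; rewrite mulf_neq0// gt_eqF// /flat_coord flat_gt0//.
  by rewrite mul1r addrCA subrr addr0.
by rewrite mulN1r addrCA addNr addr0.
Qed.

End Bump.

(** * Differential operators and their transposes *)

Section Operators.
Variables (R : realType) (d : nat).
Local Notation E := 'rV[R]_d.
Implicit Types (U : set E) (w : seq 'I_d).

Lemma dw_cst0 (W : normedModType R) w : dw w (fun _ : E => 0 : W) = fun=> 0.
Proof. by elim: w => //= i w ->; rewrite pd_cst. Qed.

Lemma smoothB (W : normedModType R) U (f g : E -> W) : open U -> smooth U f -> smooth U g ->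
  smooth U (fun x => f x - g x).
Proof.
move=> oU sf sg; apply: smoothD => // k; elim: k g sg => [|k ih] g sg.
  by split => // x Ux; exact: (continuousN (smooth_continuous sg Ux)).
split; first by move=> x Ux; exact: (continuousN (smooth_continuous sg Ux)).
move=> i; split; first by move=> x Ux; apply: derivableN; exact: smooth_derivable Ux.
apply: Ck_ext (ih _ (smooth_pd i sg)) => // x Ux.
by rewrite /pd -deriveN//; exact: smooth_derivable Ux.
Qed.

Lemma dwB (W : normedModType R) U w (f g : E -> W) (x : E) :
  open U -> smooth U f -> smooth U g -> U x ->
  dw w (fun y => f y - g y) x = dw w f x - dw w g x.
Proof.
move=> oU sf sg; elim: w x => //= i w ih x Ux.
rewrite (eq_on_pd _ oU ih Ux) /pd deriveB//.
  exact: (smooth_derivable (i := i) (smooth_dw w sf) Ux).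
exact: (smooth_derivable (i := i) (smooth_dw w sg) Ux).
Qed.

Lemma dw_mx U w (m n : nat) (F : E -> 'M[R]_(m, n)) a b (x : E) :
  open U -> smooth U F -> U x -> dw w F x a b = dw w (fun y => F y a b) x.
Proof.
move=> oU sF; elim: w x => //= i w ih x Ux.
rewrite pd_mx; first exact: (eq_on_pd i oU ih Ux).
exact: (smooth_derivable (i := i) (smooth_dw w sF) Ux).
Qed.

Section Operator.
Variables (n m : nat) (L : ldo R d n m).
Local Notation N := (ldo_ord L).
Local Notation word beta := (mword (mval beta)).

Lemma smooth_ldo_coef alpha a j : smooth setT (fun x => ldo_coef L alpha x a j).
Proof.
exact: (proj1 (smooth_mxP _ openT) (ldo_coef_smooth L alpha)).
Qed.

Lemma eq_on_ldo_app U (u v : E -> 'cV[R]_n) : open U -> (forall x, U x -> u x = v x) ->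
  forall x, U x -> ldo_app L u x = ldo_app L v x.
Proof.
move=> oU uv x Ux; apply: eq_bigr => beta _; congr (_ *m _).
by rewrite !pdiffE; exact: eq_on_dw oU uv x Ux.
Qed.

Lemma ldo_app0 x : ldo_app L (fun=> 0) x = 0.
Proof. by rewrite /ldo_app big1// => beta _; rewrite pdiffE dw_cst0 mulmx0. Qed.

Lemma ldo_appB U (u v : E -> 'cV[R]_n) x : open U -> smooth U u -> smooth U v -> U x ->
  ldo_app L (fun y => u y - v y) x = ldo_app L u x - ldo_app L v x.
Proof.
move=> oU su sv Ux; rewrite /ldo_app -sumrB; apply: eq_bigr => beta _.
by rewrite !pdiffE (dwB _ oU su sv Ux) mulmxBr.
Qed.

Lemma ldo_appE U (u : E -> 'cV[R]_n) x a : open U -> smooth U u -> U x ->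
  ldo_app L u x a 0 = \sum_(beta : bindex d N | (mabs (mval beta) <= N)%N) \sum_j
    ldo_coef L (mval beta) x a j * dw (word beta) (fun y => u y j 0) x.
Proof.
move=> oU su Ux; rewrite summxE; apply: eq_bigr => beta _; rewrite mxE.
by apply: eq_bigr => j _; rewrite pdiffE (dw_mx _ _ _ oU su Ux).
Qed.

Lemma smooth_ldo_app U (u : E -> 'cV[R]_n) : open U -> smooth U u -> smooth U (ldo_app L u).
Proof.
move=> oU su; apply: (proj2 (smooth_mxP _ oU)) => a b; rewrite ord1.
apply: (smooth_ext oU (fun x Ux => esym (ldo_appE a oU su Ux))).
apply: (@smooth_sum _ _ _ _ _ (fun beta : bindex d N => (mabs (mval beta) <= N)%N) U
  (fun beta x => \sum_j ldo_coef L (mval beta) x a j * dw (word beta) (fun y : E => u y j 0) x) oU) => beta _.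
apply: (@smooth_sum _ _ _ _ _ xpredT U
  (fun j x => ldo_coef L (mval beta) x a j * dw (word beta) (fun y : E => u y j 0) x) oU) => j _.
 apply: (smoothM oU).
  by apply: smooth_sub (smooth_ldo_coef _ _ _).
by apply: smooth_dw; exact: (proj1 (smooth_mxP _ oU) su).
Qed.

(** The entry of the formal transpose that takes a test function for component [a] of the image to
    one for component [j] of the argument. *)
Definition adj a j (phi : E -> R) : E -> R := fun x =>
  \sum_(beta : bindex d N | (mabs (mval beta) <= N)%N)
    (-1) ^+ mabs (mval beta) * dw (word beta) (fun y => ldo_coef L (mval beta) y a j * phi y) x.

Lemma test_adj a j phi : test_function phi -> test_function (adj a j phi).
Proof.
move=> tphi; apply: test_sum => beta _; apply: test_scale; apply: test_dw.
by apply: test_mul => //; exact: smooth_ldo_coef.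
Qed.

Lemma support_adj a j phi : support_of (adj a j phi) `<=` support_of phi.
Proof.
apply: support_sub => x xS; rewrite /adj big1// => beta _.
rewrite dw_notin_support ?mulr0//.
by move=> /support_mul.
Qed.

Lemma integral_adj U (u : E -> 'cV[R]_n) a phi : open U -> smooth U u ->
  test_function phi -> support_of phi `<=` U ->
  integral_Rd (fun x => ldo_app L u x a 0 * phi x) =
  \sum_j integral_Rd (fun x => u x j 0 * adj a j phi x).
Proof.
move=> oU su tphi phiU.
pose cphi (beta : bindex d N) j x := ldo_coef L (mval beta) x a j * phi x.
have tc beta j : test_function (cphi beta j).
  by apply: test_mul => //; exact: smooth_ldo_coef.
have cU beta j : support_of (cphi beta j) `<=` U.
  by apply: subset_trans phiU; exact: support_mul.
have suj j : smooth U (fun y => u y j 0) by exact: (proj1 (smooth_mxP _ oU) su).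
have t1 beta j : test_function (fun x => dw (word beta) (fun y => u y j 0) x * cphi beta j x).
  by apply: test_mul_on oU _ (tc _ _) (cU _ _); apply: smooth_dw.
have t2 beta j : test_function (fun x => u x j 0 * dw (word beta) (cphi beta j) x).
  apply: test_mul_on oU (suj j) (test_dw _ (tc _ _)) _.
  by apply: subset_trans (cU beta j); exact: support_dw.
transitivity (integral_Rd (fun x =>
    \sum_(beta : bindex d N | (mabs (mval beta) <= N)%N) \sum_j
      dw (word beta) (fun y => u y j 0) x * cphi beta j x)).
  congr integral_Rd; apply/funext => x.
  have [xS|xS] := pselect (support_of phi x).
    rewrite (ldo_appE a oU su (phiU _ xS)) mulr_suml; apply: eq_bigr => beta _.
    rewrite mulr_suml; apply: eq_bigr => j _.
    by rewrite /cphi -mulrA mulrCA.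
  rewrite (notin_support xS) mulr0 big1// => beta _; rewrite big1// => j _.
  by rewrite /cphi (notin_support xS) !mulr0.
rewrite integral_test_sum; last by move=> beta _; apply: test_sum.
rewrite (eq_bigr (fun beta => \sum_j integral_Rd (fun x =>
    dw (word beta) (fun y => u y j 0) x * cphi beta j x))); last first.
  by move=> beta _; rewrite integral_test_sum.
rewrite exchange_big /=; apply: eq_bigr => j _.
transitivity (integral_Rd (fun x =>
    \sum_(beta : bindex d N | (mabs (mval beta) <= N)%N)
      (-1) ^+ mabs (mval beta) * (u x j 0 * dw (word beta) (cphi beta j) x))).
  rewrite integral_test_sum; last by move=> beta _; exact: test_scale.
  apply: eq_bigr => beta _; rewrite integral_testZ//.
  by rewrite (integral_by_parts_dw _ oU (suj j) (tc _ _) (cU _ _)) size_mword.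
congr integral_Rd; apply/funext => x; rewrite mulr_sumr; apply: eq_bigr => beta _.
by rewrite mulrCA.
Qed.

End Operator.

(** The maps are arbitrary, not given by coefficients, so composites and sums are covered.
    Quantifying over [U] lets one transpose serve both the global functions of the hypotheses and
    the local ones of the application. *)
Definition transposed (n m : nat) (M : (E -> 'cV[R]_n) -> E -> 'cV[R]_m)
    (Mt : 'I_m -> 'I_n -> (E -> R) -> E -> R) : Prop :=
  [/\ forall U u, open U -> smooth U u -> smooth U (M u),
      forall a j phi, test_function phi ->
        test_function (Mt a j phi) /\ support_of (Mt a j phi) `<=` support_of phi &
      forall U u a phi, open U -> smooth U u -> test_function phi -> support_of phi `<=` U ->
        integral_Rd (fun x => M u x a 0 * phi x) =
        \sum_j integral_Rd (fun x => u x j 0 * Mt a j phi x)].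

Lemma transposed_ldo n m (L : ldo R d n m) : transposed (ldo_app L) (adj L).
Proof.
split.
- by move=> U u oU; exact: smooth_ldo_app.
- by move=> a j phi tphi; split; [exact: test_adj|exact: support_adj].
- by move=> U u a phi; exact: integral_adj.
Qed.

Lemma test_mul_entry U n (u : E -> 'cV[R]_n) j phi : open U -> smooth U u ->
  test_function phi -> support_of phi `<=` U -> test_function (fun x => u x j 0 * phi x).
Proof.
by move=> oU su; apply: (test_mul_on oU); exact: (proj1 (smooth_mxP _ oU) su).
Qed.

Lemma transposed_comp n l m (M1 : (E -> 'cV[R]_l) -> E -> 'cV[R]_m) Mt1
    (M2 : (E -> 'cV[R]_n) -> E -> 'cV[R]_l) Mt2 :
  transposed M1 Mt1 -> transposed M2 Mt2 ->
  transposed (fun u => M1 (M2 u))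
    (fun a j phi x => \sum_(k < l) Mt2 k j (Mt1 a k phi) x).
Proof.
move=> [s1 t1 i1] [s2 t2 i2].
have t12 a j k phi : test_function phi -> test_function (Mt2 k j (Mt1 a k phi)) /\
    support_of (Mt2 k j (Mt1 a k phi)) `<=` support_of phi.
  move=> tphi; have [t1' s1'] := t1 a k _ tphi; have [t2' s2'] := t2 k j _ t1'.
  by split=> //; exact: subset_trans s1'.
split.
- by move=> U u oU su; apply: s1 => //; exact: s2.
- move=> a j phi tphi; split; first by apply: test_sum => k _; exact: (t12 _ _ _ _ tphi).1.
  apply: support_sub => x xS; rewrite big1// => k _; apply: notin_support.
  by move=> /(t12 _ _ _ _ tphi).2.
- move=> U u a phi oU su tphi phiU.
  rewrite (i1 U)//; last exact: s2.
  rewrite (eq_bigr (fun k => \sum_j integral_Rd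
      (fun x => u x j 0 * Mt2 k j (Mt1 a k phi) x))); last first.
    move=> k _; rewrite (i2 U)//; first exact: (t1 _ _ _ tphi).1.
    exact: subset_trans (t1 _ _ _ tphi).2 phiU.
  rewrite exchange_big /=; apply: eq_bigr => j _.
  rewrite -integral_test_sum; last first.
    move=> k _; apply: test_mul_entry oU su (t12 _ _ _ _ tphi).1 _.
    exact: subset_trans (t12 _ _ _ _ tphi).2 phiU.
  by congr integral_Rd; apply/funext => x; rewrite mulr_sumr.
Qed.

Lemma transposed_add n m (M1 M2 : (E -> 'cV[R]_n) -> E -> 'cV[R]_m) Mt1 Mt2 :
  transposed M1 Mt1 -> transposed M2 Mt2 ->
  transposed (fun u x => M1 u x + M2 u x) (fun a j phi x => Mt1 a j phi x + Mt2 a j phi x).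
Proof.
move=> [s1 t1 i1] [s2 t2 i2]; split.
- by move=> U u oU su; apply: smoothD => //; [exact: s1|exact: s2].
- move=> a j phi tphi; split.
    by apply: testD; [exact: (t1 _ _ _ tphi).1|exact: (t2 _ _ _ tphi).1].
  apply: support_sub => x xS.
  have x1 : ~ support_of (Mt1 a j phi) x by move=> /(t1 _ _ _ tphi).2.
  have x2 : ~ support_of (Mt2 a j phi) x by move=> /(t2 _ _ _ tphi).2.
  by rewrite (notin_support x1) (notin_support x2) addr0.
- move=> U u a phi oU su tphi phiU.
  have h1 j : test_function (fun x => u x j 0 * Mt1 a j phi x).
    apply: test_mul_entry oU su (t1 _ _ _ tphi).1 _.
    exact: subset_trans (t1 _ _ _ tphi).2 phiU.
  have h2 j : test_function (fun x => u x j 0 * Mt2 a j phi x).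
    apply: test_mul_entry oU su (t2 _ _ _ tphi).1 _.
    exact: subset_trans (t2 _ _ _ tphi).2 phiU.
  under [in LHS]eq_fun do rewrite mxE mulrDl.
  rewrite integral_testD; first last.
  + exact: test_mul_entry oU (s2 _ _ oU su) tphi phiU.
  + exact: test_mul_entry oU (s1 _ _ oU su) tphi phiU.
  rewrite (i1 U)// (i2 U)// -big_split /=; apply: eq_bigr => j _.
  rewrite -integral_testD//.
  by congr integral_Rd; apply/funext => x; rewrite mulrDr.
Qed.

Lemma transposed_id n :
  transposed (fun u : E -> 'cV[R]_n => u) (fun a j phi x => (a == j)%:R * phi x).
Proof.
split=> //.
- move=> a j phi tphi; split; first exact: test_scale.
  exact: support_mul.
- move=> U u a phi oU su tphi phiU; rewrite (bigD1 a)//= [X in _ + X]big1 ?addr0.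
    by congr integral_Rd; apply/funext => x; rewrite eqxx mul1r.
  move=> j ja; rewrite -[RHS](@integral_test0 R d); congr integral_Rd; apply/funext => x.
  by rewrite eq_sym (negbTE ja) mul0r mulr0.
Qed.

Section Agreement.
Variables (n m : nat) (M N : (E -> 'cV[R]_n) -> E -> 'cV[R]_m).
Variables (Mt Nt : 'I_m -> 'I_n -> (E -> R) -> E -> R).
Hypotheses (tM : transposed M Mt) (tN : transposed N Nt).
Hypothesis MN : forall u, smooth setT u -> forall x, M u x = N u x.

(* Test the difference psi of the two transposes against itself. *)
Lemma eq_transposed a j phi : test_function phi -> Mt a j phi = Nt a j phi.
Proof.
move=> tphi; have [_ tMt iM] := tM; have [_ tNt iN] := tN.
pose psi x := -1 * Nt a j phi x + Mt a j phi x.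
have tpsi : test_function psi by apply: test_lin; [exact: (tNt _ _ _ tphi).1|exact: (tMt _ _ _ tphi).1].
(* Placing [psi] in component [j] isolates one entry of the transposes; being globally smooth, [u]
   falls under [MN]. *)
pose u (x : E) : 'cV[R]_n := \col_k ((k == j)%:R * psi x).
have su : smooth setT u.
  apply: (proj2 (smooth_mxP _ openT)) => k b; under eq_fun do rewrite mxE.
  by apply: smooth_scale; [exact: openT|case: tpsi].
have sumE (F : 'I_n -> E -> R) :
    \sum_k integral_Rd (fun x => u x k 0 * F k x) = integral_Rd (fun x => psi x * F j x).
  rewrite (bigD1 j)//= [X in _ + X]big1 ?addr0.
    by congr integral_Rd; apply/funext => x; rewrite mxE eqxx mul1r.
  move=> k kj; rewrite -[RHS](@integral_test0 R d); congr integral_Rd; apply/funext => x.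
  by rewrite mxE (negbTE kj) !mul0r.
have eI : integral_Rd (fun x => psi x * Mt a j phi x) = integral_Rd (fun x => psi x * Nt a j phi x).
  rewrite -(sumE (fun k => Mt a k phi)) -(sumE (fun k => Nt a k phi)).
  have subT : support_of phi `<=` setT by [].
  rewrite -(iM setT u a phi openT su tphi subT) -(iN setT u a phi openT su tphi subT).
  by congr integral_Rd; apply/funext => x; rewrite MN.
apply/funext => x; apply/eqP; rewrite -subr_eq0 addrC -mulN1r; apply/eqP.
apply: (integral_sqr_eq0 tpsi).
transitivity (integral_Rd (fun x => -1 * (psi x * Nt a j phi x) + psi x * Mt a j phi x)).
  by congr integral_Rd; apply/funext => y; rewrite [X in _ * X]/psi mulrDr mulrCA.
rewrite integral_test_lin; last 2 first.
- by apply: test_mul; [case: tpsi|exact: (tNt _ _ _ tphi).1].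
- by apply: test_mul; [case: tpsi|exact: (tMt _ _ _ tphi).1].
by rewrite eI mulN1r addNr.
Qed.

(* Equality of the transposes is equality in the weak sense; it is made pointwise by
   testing the difference h against h chi^2 for a bump function chi at x. *)
Lemma eq_on_transposed U u x : open U -> smooth U u -> U x -> M u x = N u x.
Proof.
move=> oU su Ux; have [sM tMt iM] := tM; have [sN tNt iN] := tN.
have [chi [tchi chiU chix]] := exists_bump oU Ux.
apply/colP => a.
pose h (y : E) := M u y a 0 - N u y a 0.
have sMa : smooth U (fun y => M u y a 0) by exact: (proj1 (smooth_mxP _ oU) (sM _ _ oU su)).
have sNa : smooth U (fun y => N u y a 0) by exact: (proj1 (smooth_mxP _ oU) (sN _ _ oU su)).
have sh : smooth U h by exact: smoothB.
have thc : test_function (fun y => h y * chi y) by exact: test_mul_on oU sh tchi chiU.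
pose phi y := chi y * (h y * chi y).
have tphi : test_function phi by apply: test_mul => //; case: tchi.
have phiU : support_of phi `<=` U.
  by move=> y /support_mul /support_mul; exact: chiU.
have I0 : integral_Rd (fun y => (h y * chi y) * (h y * chi y)) = 0.
  transitivity (integral_Rd (fun y => -1 * (N u y a 0 * phi y) + M u y a 0 * phi y)).
    by congr integral_Rd; apply/funext => y; rewrite /phi /h; ring.
  rewrite integral_test_lin; last 2 first.
  - exact: test_mul_on oU sNa tphi phiU.
  - exact: test_mul_on oU sMa tphi phiU.
  rewrite (iM U)// (iN U)// mulN1r; apply/eqP; rewrite addrC subr_eq0; apply/eqP.
  by apply: eq_bigr => j _; rewrite eq_transposed.
have /eqP := integral_sqr_eq0 thc I0 x.
by rewrite mulf_eq0 (negbTE chix) orbF subr_eq0 => /eqP.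
Qed.

End Agreement.

End Operators.

(** * Estimates and distributions *)

Section Estimates.
Variables (R : realType) (d : nat).
Local Notation E := 'rV[R]_d.
Implicit Types (U V K : set E) (w : seq 'I_d) (f g phi psi : E -> R) (k : nat) (r c : R).

(** A real-valued substitute for [Ck_norm], ranging over words so that it composes with [dw]. For
    [f] smooth near [K] and [0 <= r] it says the same as a bound on the norm, by
    [Ck_norm_bounded]. *)
Definition Ck_bounded k K f r : Prop :=
  forall w, (size w <= k)%N -> forall x, K x -> `|dw w f x| <= r.

Lemma Ck_bounded_le k k' K f r : (k <= k')%N -> Ck_bounded k' K f r -> Ck_bounded k K f r.
Proof. by move=> kk h w wk; apply: h; exact: leq_trans kk. Qed.

Lemma Ck_bounded_ler k K f r r' : r <= r' -> Ck_bounded k K f r -> Ck_bounded k K f r'.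
Proof. by move=> rr h w wk x Kx; apply: le_trans rr; exact: h. Qed.

Lemma Ck_bounded_ext k K V f g r : open V -> K `<=` V -> (forall x, V x -> f x = g x) ->
  Ck_bounded k K f r -> Ck_bounded k K g r.
Proof.
move=> oV KV fg h w wk x Kx.
by rewrite -(eq_on_dw w oV fg (KV _ Kx)); exact: h.
Qed.

Lemma Ck_bounded_dw k K f r w : Ck_bounded (k + size w) K f r -> Ck_bounded k K (dw w f) r.
Proof.
move=> h v vk x Kx; rewrite -dw_cat; apply: h => //.
by rewrite size_cat leq_add2r.
Qed.

Lemma Ck_boundedD k K V f g r r' : open V -> K `<=` V -> smooth V f -> smooth V g ->
  Ck_bounded k K f r -> Ck_bounded k K g r' -> Ck_bounded k K (fun x => f x + g x) (r + r').
Proof.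
move=> oV KV sf sg hf hg w wk x Kx.
rewrite (dwD w oV sf sg (KV _ Kx)) (le_trans (ler_normD _ _))// lerD//.
  exact: hf.
exact: hg.
Qed.

Lemma Ck_bounded_sum (I : Type) (s : seq I) (P : pred I) (F : I -> E -> R) k K V (C : I -> R) :
  open V -> K `<=` V -> (forall i, P i -> smooth V (F i)) ->
  (forall i, P i -> Ck_bounded k K (F i) (C i)) ->
  Ck_bounded k K (fun x => \sum_(i <- s | P i) F i x) (\sum_(i <- s | P i) C i).
Proof.
move=> oV KV sF hF; elim: s => [|i s ih].
  under eq_fun do rewrite big_nil; rewrite big_nil => w _ x _.
  by rewrite dw_cst0 normr0.
under eq_fun do rewrite big_cons; rewrite big_cons; case Pi: (P i) => //.
by apply: (Ck_boundedD oV KV) => //; [exact: sF|exact: smooth_sum|exact: hF].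
Qed.

Lemma exists_Ck_bound k K V f : compact K -> open V -> K `<=` V -> smooth V f ->
  exists2 r, 0 <= r & Ck_bounded k K f r.
Proof.
move=> cK oV KV; elim: k f => [|k ih] f sf.
  have : compact (f @` K).
    apply: continuous_compact => //; apply: continuous_in_subspaceT => x /set_mem Kx.
    exact: smooth_continuous sf (KV _ Kx).
  move=> /compact_bounded/pinfty_ex_gt0[M M0 hM]; exists M; first exact: ltW.
  move=> w; rewrite leqn0 size_eq0 => /eqP -> x Kx /=.
  by apply: hM; exists x.
have [r r0 hr] := ih f sf.
have /fin_all_exists[C hC] (i : 'I_d) : exists c, 0 <= c /\ Ck_bounded k K (pd i f) c.
  by have [c c0 hc] := ih _ (smooth_pd i sf); exists c.
exists (r + \sum_i C i).
  by rewrite addr_ge0// sumr_ge0// => i _; have [] := hC i.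
(* The last letter is the innermost derivative: removing it leaves a word of length at most [k]
   applied to [pd i f], where the induction hypothesis applies. *)
move=> w wk x Kx; case: (lastP w) wk => [_|v i].
  apply: (@le_trans _ _ r); first exact: hr.
  by rewrite lerDl sumr_ge0// => i _; have [] := hC i.
rewrite size_rcons ltnS => vk; rewrite -cats1 dw_cat.
apply: (@le_trans _ _ (C i)); first exact: (hC i).2.
rewrite (bigD1 i)//= addrCA lerDl addr_ge0// sumr_ge0// => j _.
by have [] := hC j.
Qed.

Lemma Ck_bounded_mul k K (c : E -> R) : compact K -> smooth setT c ->
  exists2 C, 0 <= C & forall V f r, open V -> K `<=` V -> smooth V f -> 0 <= r ->
    Ck_bounded k K f r -> Ck_bounded k K (fun x => c x * f x) (C * r).
Proof.
move=> cK sc; have [B B0 hB] := exists_Ck_bound k cK openT (@subsetT _ K) sc.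
(* Leibniz's rule has at most [2 ^ k] terms, each bounded by [B * r]; the constant depends on [c],
   [k] and [K] but not on [f] or [V]. *)
exists ((2 ^ k)%:R * B); first by rewrite mulr_ge0.
move=> V f r oV KV sf r0 hf w wk x Kx.
have scV : smooth V c by apply: smooth_sub sc.
rewrite (leibniz w oV scV sf (KV _ Kx)).
apply: (@le_trans _ _ (\sum_(t <- splits w) B * r)).
  apply: (le_trans (ler_norm_sum _ _ _)); rewrite big_seq [leRHS]big_seq.
  apply: ler_sum => t tw; have sz := size_splits tw.
  by rewrite normrM ler_pM// ?hB ?hf// (leq_trans _ wk)// -sz ?leq_addl// leq_addr.
rewrite big_const_seq count_predT iter_addr_0 -[leLHS]mulr_natl -(mulrA _ B r).
apply: ler_wpM2r; first exact: mulr_ge0.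
rewrite ler_nat; have -> : size (splits w) = (2 ^ size w)%N; last by rewrite leq_exp2l.
by elim: (w) => //= i v ih; rewrite size_cat !size_map ih addnn -mul2n expnS.
Qed.

Lemma Ck_norm_leP (W : normedModType R) k K (F : E -> W) c : 0 <= c ->
  (Ck_norm k K F <= c%:E)%E <->
  forall beta : bindex d k, (mabs (mval beta) <= k)%N ->
    forall x, K x -> `|pdiff (mval beta) F x| <= c.
Proof.
move=> c0; split.
  move=> /bigmax_leP[_ h] beta bk x Kx; rewrite -lee_fin; apply: le_trans (h beta bk).
  by apply: ereal_sup_ubound; exists x.
move=> h; apply/bigmax_leP; split; first by rewrite lee_fin.
move=> beta bk; apply: ge_ereal_sup => _ [x Kx <-].
by rewrite lee_fin; exact: h.
Qed.

Lemma Ck_norm_ge0 (W : normedModType R) k K (F : E -> W) : (0 <= Ck_norm k K F)%E.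
Proof. exact: bigmax_ge_id. Qed.

Lemma pdiff_Ck_bounded k K V f c : open V -> K `<=` V -> smooth V f ->
  (forall beta : bindex d k, (mabs (mval beta) <= k)%N ->
    forall x, K x -> `|pdiff (mval beta) f x| <= c) <-> Ck_bounded k K f c.
Proof.
move=> oV KV sf; split=> [h w wk x Kx|h beta bk x Kx].
  rewrite (dw_pdiff w oV sf (KV _ Kx)).
  have [beta be] : exists beta : bindex d k, mval beta = wcount w.
    by apply: bindexP; rewrite mabs_wcount.
  by rewrite -be; apply: h => //; rewrite be mabs_wcount.
by rewrite pdiffE; apply: h => //; rewrite size_mword.
Qed.

Lemma Ck_norm_bounded k K V f c : open V -> K `<=` V -> smooth V f -> 0 <= c ->
  (Ck_norm k K f <= c%:E)%E <-> Ck_bounded k K f c.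
Proof.
move=> oV KV sf c0; have h1 := Ck_norm_leP k K f c0.
by have h2 := pdiff_Ck_bounded k c oV KV sf; split=> [/h1/h2|/h2/h1].
Qed.

Lemma Ck_norm_mx_bounded k K V n (F : E -> 'cV[R]_n) c :
  open V -> K `<=` V -> smooth V F -> 0 <= c ->
  (Ck_norm k K F <= c%:E)%E <-> forall j, Ck_bounded k K (fun x => F x j 0) c.
Proof.
move=> oV KV sF c0; have h1 := Ck_norm_leP k K F c0.
have sFj j : smooth V (fun x => F x j 0) by exact: (proj1 (smooth_mxP _ oV) sF).
have h2 j := pdiff_Ck_bounded k c oV KV (sFj j).
have e beta x j : K x -> pdiff (mval beta) F x j 0 = pdiff (mval beta) (fun x => F x j 0) x.
  by move=> Kx; rewrite !pdiffE (dw_mx _ _ _ oV sF (KV _ Kx)).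
split=> [/h1 h j|h]; [apply/h2|apply/h1] => beta bk x Kx.
  have /(mx_normP _ c0)/(_ j 0) := h beta bk x Kx.
  by rewrite e.
apply/mx_normP => // j b; rewrite ord1 e//.
by apply: (proj2 (h2 j)).
Qed.

Definition test_linear (T : functional R d) : Prop :=
  forall (a : R) phi psi, test_function phi -> test_function psi ->
    T (fun x => a * phi x + psi x) = a * T phi + T psi.

Lemma is_distributionP (T : functional R d) : is_distribution T <->
  test_linear T /\ forall K, compact K -> exists C k, 0 <= C /\
    forall phi r, test_function phi -> support_of phi `<=` K -> 0 <= r ->
      Ck_bounded k K phi r -> `|T phi| <= C * r.
Proof.
split=> -[lT bT]; split=> // K cK; have [C [k]] := bT K cK.
  move=> h; exists (Num.max C 0), k; split; first by rewrite le_max lexx orbT.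
  move=> phi r tphi phiK r0 hr.
  have hN : (Ck_norm k K phi <= r%:E)%E.
    by apply/(Ck_norm_bounded k openT (@subsetT _ K) tphi.1 r0).
  rewrite -lee_fin; apply: le_trans (h _ tphi phiK) _.
  apply: (@le_trans _ _ ((Num.max C 0)%:E * Ck_norm k K phi)%E).
    by apply: lee_wpmul2r; [exact: Ck_norm_ge0|rewrite lee_fin le_max lexx].
  by rewrite EFinM; apply: lee_wpmul2l => //; rewrite lee_fin le_max lexx orbT.
move=> [C0 h]; exists C, k => phi tphi phiK.
(* The bound [B] serves only to show that the extended-real norm is finite; the estimate [h] is then
   applied with the norm itself as radius. *)
have [B B0 hB] := exists_Ck_bound k cK openT (@subsetT _ K) tphi.1.
have hN : (Ck_norm k K phi <= B%:E)%E.
  by apply/(Ck_norm_bounded k openT (@subsetT _ K) tphi.1 B0).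
have N0 := Ck_norm_ge0 k K phi.
move: (hN) N0; case e : (Ck_norm k K phi) => [r| |]// _.
rewrite lee_fin => r0; rewrite -EFinM lee_fin; apply: h => //.
by apply/(Ck_norm_bounded k openT (@subsetT _ K) tphi.1 r0); rewrite e.
Qed.

Section TestLinear.
Variable T : functional R d.
Hypothesis lT : test_linear T.

Lemma test_linear0 : T (fun=> 0) = 0.
Proof.
have := lT (-1) (@test0 R d) (@test0 R d); under eq_fun do rewrite mulr0 addr0.
by move=> ->; rewrite mulN1r addNr.
Qed.

Lemma test_linearZ (a : R) phi : test_function phi -> T (fun x => a * phi x) = a * T phi.
Proof.
move=> tphi; have := lT a tphi (@test0 R d); rewrite test_linear0 addr0 => <-.
by under [in RHS]eq_fun do rewrite addr0.
Qed.

Lemma test_linear_sum (I : Type) (s : seq I) (P : pred I) (F : I -> E -> R) :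
  (forall i, P i -> test_function (F i)) ->
  T (fun x => \sum_(i <- s | P i) F i x) = \sum_(i <- s | P i) T (F i).
Proof.
move=> tF; elim: s => [|i s ih].
  by under eq_fun do rewrite big_nil; rewrite big_nil test_linear0.
under eq_fun do rewrite big_cons; rewrite big_cons; case Pi: (P i) => //.
rewrite -ih -[in RHS](mul1r (T (F i))) -lT; [|exact: tF|exact: test_sum].
by under [in RHS]eq_fun do rewrite mul1r.
Qed.

End TestLinear.

Lemma is_distribution_ext (T S : functional R d) : (forall phi, test_function phi -> T phi = S phi) ->
  is_distribution T -> is_distribution S.
Proof.
move=> TS [lT bT]; split.
  by move=> a phi psi tphi tpsi; rewrite -!TS//; [exact: lT|exact: test_lin].
move=> K cK; have [c [k h]] := bT K cK; exists c, k => phi tphi phiK.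
by rewrite -TS//; exact: h.
Qed.

Lemma is_distributionD (T S : functional R d) : is_distribution T -> is_distribution S ->
  is_distribution (fun phi => T phi + S phi).
Proof.
move=> /is_distributionP[lT bT] /is_distributionP[lS bS]; apply/is_distributionP; split.
  by move=> a phi psi tphi tpsi; rewrite lT// lS// mulrDr addrACA.
move=> K cK; have [C1 [k1 [C10 h1]]] := bT K cK; have [C2 [k2 [C20 h2]]] := bS K cK.
exists (C1 + C2), (maxn k1 k2); split; first exact: addr_ge0.
move=> phi r tphi phiK r0 hr; rewrite mulrDl (le_trans (ler_normD _ _))// lerD//.
  by apply: h1 => //; apply: Ck_bounded_le hr; exact: leq_maxl.
by apply: h2 => //; apply: Ck_bounded_le hr; exact: leq_maxr.
Qed.

Lemma is_distribution_sum (I : Type) (s : seq I) (T : I -> functional R d) :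
  (forall i, is_distribution (T i)) -> is_distribution (fun phi => \sum_(i <- s) T i phi).
Proof.
move=> dT; elim: s => [|i s ih].
  apply/is_distributionP; split; first by move=> a phi psi _ _; rewrite !big_nil mulr0 addr0.
  move=> K _; exists 0, 0%N; split => // phi r _ _ _ _.
  by rewrite big_nil normr0 mul0r.
apply: is_distribution_ext (is_distributionD (dT i) ih) => phi _.
by rewrite big_cons.
Qed.

Lemma is_distribution_fun f : smooth setT f -> is_distribution (dist_of_fun f).
Proof.
move=> sf; apply/is_distributionP; split.
  move=> a phi psi tphi tpsi; rewrite /dist_of_fun -integral_test_lin; try exact: test_mul.
  by congr integral_Rd; apply/funext => x; rewrite mulrDr mulrCA.
move=> K cK; have [B B0 hB] := exists_Ck_bound 0 cK openT (@subsetT _ K) sf.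
have /compact_bounded/pinfty_ex_gt0[M M0 hM] := cK.
have [C C0 hC] := integral_Rd_bound d M0.
exists (C * B), 0%N; split; first by rewrite mulr_ge0// ltW.
move=> phi r tphi phiK r0 hr; rewrite -mulrA; apply: hC.
  split; first exact: test_continuous (test_mul sf tphi).
  move=> x xM; rewrite (@notin_support _ _ phi x) ?mulr0// => /phiK/hM /=.
  by rewrite leNgt xM.
move=> x; have [Kx|nKx] := pselect (K x).
  by rewrite normrM ler_pM//; [exact: (hB [::])|exact: (hr [::])].
by rewrite (@notin_support _ _ phi x) ?mulr0 ?normr0 ?mulr_ge0// => /phiK.
Qed.

(** * Differential operators on distributions and their C^k estimates *)

Section Adjoint.
Variables (n m : nat) (L : ldo R d n m).

Lemma Ck_bounded_term k K a j beta : compact K -> (mabs (mval beta) <= ldo_ord L)%N ->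
  exists C, 0 <= C /\ forall V f r, open V -> K `<=` V -> smooth V f -> 0 <= r ->
    Ck_bounded (k + ldo_ord L) K f r ->
    Ck_bounded k K (dw (mword (mval (beta : bindex d (ldo_ord L))))
      (fun y => ldo_coef L (mval beta) y a j * f y)) (C * r).
Proof.
move=> cK bL; have [C C0 hC] := Ck_bounded_mul (k + ldo_ord L) cK (smooth_ldo_coef L (mval beta) a j).
exists C; split=> // V f r oV KV sf r0 hf; apply: Ck_bounded_dw.
apply: Ck_bounded_le (hC _ _ _ oV KV sf r0 hf).
by rewrite size_mword leq_add2l.
Qed.

Lemma Ck_bounded_adj k K a j : compact K ->
  exists2 C, 0 <= C & forall phi r, test_function phi -> 0 <= r ->
    Ck_bounded (k + ldo_ord L) K phi r -> Ck_bounded k K (adj L a j phi) (C * r).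
Proof.
move=> cK.
have /fin_all_exists[C hC] (beta : bindex d (ldo_ord L)) : exists C, 0 <= C /\
    ((mabs (mval beta) <= ldo_ord L)%N -> forall phi r, test_function phi -> 0 <= r ->
    Ck_bounded (k + ldo_ord L) K phi r ->
    Ck_bounded k K (dw (mword (mval beta)) (fun y => ldo_coef L (mval beta) y a j * phi y)) (C * r)).
  have [bL|bL] := boolP (mabs (mval beta) <= ldo_ord L)%N; last by exists 0.
  have [C [C0 hC]] := Ck_bounded_term k a j cK bL; exists C; split=> // _ phi r tphi.
  by apply: hC; [exact: openT|exact: subsetT|case: tphi].
exists (\sum_(beta : bindex d (ldo_ord L) | (mabs (mval beta) <= ldo_ord L)%N) C beta).
  by rewrite sumr_ge0// => beta _; have [] := hC beta.
move=> phi r tphi r0 hr; rewrite mulr_suml.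
have tc beta : test_function (dw (mword (mval beta))
    (fun y => ldo_coef L (mval (beta : bindex d (ldo_ord L))) y a j * phi y)).
  by apply: test_dw; apply: test_mul => //; exact: smooth_ldo_coef.
apply: (@Ck_bounded_sum _ _ _ _ k K setT) => //; first exact: openT.
  by move=> beta _; case: (test_scale ((-1) ^+ mabs (mval beta)) (tc beta)).
move=> beta bL w wk x Kx; rewrite (dwZ w _ openT (tc beta).1)// normrM normrX normrN1 expr1n mul1r.
by apply: (hC beta).2.
Qed.

Lemma adj_linear a j : forall (s : R) phi psi, test_function phi -> test_function psi ->
  adj L a j (fun x => s * phi x + psi x) = fun x => s * adj L a j phi x + adj L a j psi x.
Proof.
move=> s phi psi tphi tpsi; apply/funext => x.
rewrite /adj mulr_sumr -big_split /=; apply: eq_bigr => beta _.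
have t1 : test_function (fun y => ldo_coef L (mval beta) y a j * phi y).
  by apply: test_mul => //; exact: smooth_ldo_coef.
have t2 : test_function (fun y => ldo_coef L (mval beta) y a j * psi y).
  by apply: test_mul => //; exact: smooth_ldo_coef.
rewrite mulrCA -mulrDr -(dwZ _ s openT t1.1)// -(dwD _ openT (test_scale s t1).1 t2.1)//.
congr (_ * _); apply: (congr1 (fun h : E -> R => dw (mword (mval beta)) h x)).
by apply/funext => y; rewrite mulrDr mulrCA.
Qed.

Lemma is_distribution_adj (T : functional R d) a j : is_distribution T ->
  is_distribution (fun phi => T (adj L a j phi)).
Proof.
move=> /is_distributionP[lT bT]; apply/is_distributionP; split.
  by move=> s phi psi tphi tpsi; rewrite adj_linear// lT//; exact: test_adj.
move=> K cK; have [C [k [C0 hC]]] := bT K cK.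
have [C' C'0 hC'] := Ck_bounded_adj k a j cK.
exists (C * C'), (k + ldo_ord L)%N; split; first exact: mulr_ge0.
move=> phi r tphi phiK r0 hr; rewrite -mulrA; apply: hC.
- exact: test_adj.
- by apply: subset_trans phiK; exact: support_adj.
- exact: mulr_ge0.
- exact: hC'.
Qed.

(** On distributions an operator acts only through its transpose, so equality of transposes turns
    into an identity between distributions. *)
Lemma ldo_dist_adj (u : vfunctional R d n) a phi : (forall j, test_linear (u j)) ->
  test_function phi -> ldo_dist L u a phi = \sum_j u j (adj L a j phi).
Proof.
move=> lu tphi; rewrite /ldo_dist exchange_big /=; apply: eq_bigr => j _.
have tc beta : test_function (dw (mword (mval beta))
    (fun y => ldo_coef L (mval (beta : bindex d (ldo_ord L))) y a j * phi y)).
  by apply: test_dw; apply: test_mul => //; exact: smooth_ldo_coef.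
rewrite (test_linear_sum (lu j)); last by move=> beta _; exact: test_scale.
apply: eq_bigr => beta _; rewrite (test_linearZ (lu j))//.
by rewrite /dist_mul /dist_pdiff pdiffE.
Qed.

Lemma is_distribution_ldo (u : vfunctional R d n) a : (forall j, is_distribution (u j)) ->
  is_distribution (ldo_dist L u a).
Proof.
move=> du; apply: (@is_distribution_ext (fun phi => \sum_j u j (adj L a j phi))).
  by move=> phi tphi; rewrite ldo_dist_adj// => j; case: (du j).
by apply: is_distribution_sum => j; exact: is_distribution_adj.
Qed.

(** Continuity of [L] from C^(k + order) to C^k on [K]. The constant comes before [V] and [z]: it
    decides how accurate an approximant to request. *)
Lemma Ck_bounded_ldo k K : compact K -> exists2 C, 0 <= C &
  forall V (z : E -> 'cV[R]_n) r, open V -> K `<=` V -> smooth V z -> 0 <= r ->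
    (forall j, Ck_bounded (k + ldo_ord L) K (fun x => z x j 0) r) ->
    forall a, Ck_bounded k K (fun x => ldo_app L z x a 0) (C * r).
Proof.
move=> cK.
have /fin_all_exists[C hC] (t : 'I_m * 'I_n * bindex d (ldo_ord L)) : exists C, 0 <= C /\
    ((mabs (mval t.2) <= ldo_ord L)%N -> forall V f r, open V -> K `<=` V -> smooth V f -> 0 <= r ->
    Ck_bounded (k + ldo_ord L) K f r ->
    Ck_bounded k K (fun x => ldo_coef L (mval t.2) x t.1.1 t.1.2 * dw (mword (mval t.2)) f x) (C * r)).
  case: t => -[a j] beta /=.
  have [bL|bL] := boolP (mabs (mval beta) <= ldo_ord L)%N; last by exists 0.
  have [C C0 hC] := Ck_bounded_mul k cK (smooth_ldo_coef L (mval beta) a j).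
  exists C; split=> // _ V f r oV KV sf r0 hf; apply: (hC V) => //; first exact: smooth_dw.
  apply: Ck_bounded_dw; apply: Ck_bounded_le hf.
  by rewrite size_mword leq_add2l.
(* Summing over the row index too gives one constant valid for all components of the image. *)
exists (\sum_t C t); first by rewrite sumr_ge0// => t _; have [] := hC t.
move=> V z r oV KV sz r0 hz a.
have szj j : smooth V (fun x => z x j 0) by exact: (proj1 (smooth_mxP _ oV) sz).
apply: (Ck_bounded_ext oV KV (fun x Vx => esym (ldo_appE L a oV sz Vx))).
apply: (@Ck_bounded_ler _ _ _ (\sum_(beta : bindex d (ldo_ord L) | (mabs (mval beta) <= ldo_ord L)%N)
    \sum_j C (a, j, beta) * r)).
  have -> : \sum_(beta : bindex d (ldo_ord L) | (mabs (mval beta) <= ldo_ord L)%N) \sum_j C (a, j, beta) * r =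
      (\sum_(beta : bindex d (ldo_ord L) | (mabs (mval beta) <= ldo_ord L)%N) \sum_j C (a, j, beta)) * r.
    by rewrite mulr_suml; apply: eq_bigr => beta _; rewrite mulr_suml.
  apply: ler_wpM2r => //.
  have -> : \sum_t C t = \sum_beta \sum_b \sum_j C (b, j, beta).
    rewrite (eq_bigr (fun t => C (t.1, t.2))); last by case.
    rewrite -(pair_bigA _ (fun t beta => C (t, beta))) /= exchange_big /=.
    apply: eq_bigr => beta _; rewrite (eq_bigr (fun t => C (t.1, t.2, beta))); last by case.
    by rewrite -(pair_bigA _ (fun b j => C (b, j, beta))).
  have C0 b j beta : 0 <= C (b, j, beta) by have [] := hC (b, j, beta).
  rewrite [leRHS](bigID (fun beta : bindex d (ldo_ord L) => (mabs (mval beta) <= ldo_ord L)%N)) /=.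
  apply: ler_wpDr; first by do 3 (apply: sumr_ge0 => ? _).
  apply: ler_sum => beta _; rewrite [leRHS](bigD1 a)//= lerDl.
  by do 2 (apply: sumr_ge0 => ? _).
have scV beta j : smooth V (fun x => ldo_coef L (mval beta) x a j) .
  by apply: smooth_sub (smooth_ldo_coef _ _ _ _).
have st beta j : smooth V (fun x => ldo_coef L (mval (beta : bindex d (ldo_ord L))) x a j *
    dw (mword (mval beta)) (fun y => z y j 0) x).
  by apply: smoothM => //; exact: smooth_dw.
apply: (@Ck_bounded_sum _ _ _ _ k K V) => //.
  by move=> beta _; exact: (@smooth_sum _ _ _ _ _ xpredT V _ oV (fun j _ => st beta j)).
move=> beta bL; apply: (@Ck_bounded_sum _ _ _ _ k K V) => // j _.
by apply: ((hC (a, j, beta)).2 bL V).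
Qed.

End Adjoint.

End Estimates.

(** * Transmutations *)

Section DiracCombinations.
Variables (R : realType) (d : nat).
Local Notation E := 'rV[R]_d.
Implicit Types (A : set E) (phi psi : E -> R).

(** One list serves all components [a] at once, since the coefficients are vectors. *)
Definition is_dirac_comb m A (T : vfunctional R d m) : Prop :=
  exists s : seq (E * mindex d * 'cV[R]_m), (forall t, t \in s -> A t.1.1) /\
    forall a phi, test_function phi -> T a phi = dirac_comb s a phi.

Lemma is_dirac_comb_sum m A (I : eqType) (r : seq I) (P : pred I) (T : I -> vfunctional R d m) :
  (forall i, i \in r -> P i -> is_dirac_comb A (T i)) ->
  is_dirac_comb A (fun a phi => \sum_(i <- r | P i) T i a phi).
Proof.
elim: r => [|i r ih] hT.
  by exists [::]; split => // a phi _; rewrite /dirac_comb !big_nil.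
have [|s [sA hs]] := ih; first by move=> j jr; apply: hT; rewrite inE jr orbT.
case Pi : (P i); last first.
  by exists s; split => // a phi tphi; rewrite big_cons Pi hs.
have [s' [s'A hs']] := hT i (mem_head _ _) Pi.
exists (s' ++ s); split.
  by move=> t; rewrite mem_cat => /orP[/s'A|/sA].
by move=> a phi tphi; rewrite big_cons Pi hs// hs'// /dirac_comb big_cat.
Qed.

(** The coefficient carries the sign [(-1) ^+ size w] to cancel the one in the derivative of a Dirac
    mass. *)
Lemma is_dirac_comb_dw m A (c : 'I_m -> R) w (x : E) : A x ->
  is_dirac_comb A (fun a phi => c a * dw w phi x).
Proof.
move=> Ax; exists [:: (x, wcount w, \col_a ((-1) ^+ size w * c a))]; split.
  by move=> t; rewrite inE => /eqP ->.
move=> a phi tphi; rewrite /dirac_comb big_seq1 /= mxE /dist_pdiff /dist_dirac mabs_wcount.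
rewrite -(dw_pdiff w openT tphi.1)// (mulrC _ (c a)) -mulrA; congr (_ * _).
by rewrite mulrA -exprMn mulrNN mulr1 expr1n mul1r.
Qed.

Lemma test_linear_dirac_comb m (s : seq (E * mindex d * 'cV[R]_m)) a :
  test_linear (dirac_comb s a).
Proof.
move=> c phi psi tphi tpsi; rewrite /dirac_comb mulr_sumr -big_split /=.
apply: eq_bigr => t _; rewrite /dist_pdiff /dist_dirac !pdiffE.
rewrite (dwD _ openT (test_scale c tphi).1 tpsi.1)// (dwZ _ c openT tphi.1)//.
ring.
Qed.

(** Testing against [phi] evaluates derivatives of a coefficient times [phi] at the given points.
    Leibniz's rule turns these into derivatives of [phi] at the same points, with derivatives of the
    coefficient as weights, so no new point appears. *)
Lemma is_dirac_comb_ldo n m A (L : ldo R d n m) (s : seq (E * mindex d * 'cV[R]_n)) :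
  (forall t, t \in s -> A t.1.1) -> is_dirac_comb A (ldo_dist L (dirac_comb s)).
Proof.
move=> sA; apply: is_dirac_comb_sum => beta _ _; apply: is_dirac_comb_sum => j _ _.
pose c a (x : E) := ldo_coef L (mval beta) x a j.
pose coef (t : E * mindex d * 'cV[R]_n) (sp : seq 'I_d * seq 'I_d) a :=
  (-1) ^+ mabs (mval beta) * t.2 j 0 * (-1) ^+ mabs t.1.2 * dw sp.1 (c a) t.1.1.
have [s' [s'A hs']] : is_dirac_comb A (fun a phi => \sum_(t <- s)
    \sum_(sp <- splits (mword t.1.2 ++ mword (mval beta))) coef t sp a * dw sp.2 phi t.1.1).
  apply: is_dirac_comb_sum => t ts _; apply: is_dirac_comb_sum => sp _ _.
  by apply: is_dirac_comb_dw; exact: sA.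
exists s'; split => // a phi tphi; rewrite -hs'//.
rewrite /dist_mul /dist_pdiff /dirac_comb mulr_sumr; apply: eq_bigr => t _.
rewrite /dist_pdiff /dist_dirac !pdiffE -dw_cat.
have sc : smooth setT (c a) by exact: smooth_ldo_coef.
rewrite (leibniz _ openT sc tphi.1)// !mulr_sumr; apply: eq_bigr => sp _.
by rewrite /coef !mulrA.
Qed.

End DiracCombinations.

Theorem theorem3p24 (R : realType) (d n m p q : nat)
  (d_gt0 : (0 < d)%N) (n_gt0 : (0 < n)%N) (m_gt0 : (0 < m)%N)
  (p_gt0 : (0 < p)%N) (q_gt0 : (0 < q)%N)
  (A : ldo R d n m) (B : ldo R d p q) :
  silvern_transmutation A B ->
  runge_point_controls B ->
  runge_point_controls A.
Proof.
move=> [P [Q [R' [S [T [AP BQ PQ]]]]]] rungeB.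
move=> K f k eps pts Omega u cK [w [sw fw]] eps0 ptsK oO KO su Au.
have tr n' m' (L : ldo R d n' m') := transposed_ldo L.
have swO : smooth Omega w by apply: smooth_sub sw.
pose u0 x := u x - w x.
have su0 : smooth Omega u0 by exact: smoothB.
have Au0 x : Omega x -> ldo_app A u0 x = 0.
  by move=> Ox; rewrite (ldo_appB A oO su swO Ox) Au// fw subrr.
have BQu0 x : Omega x -> ldo_app B (ldo_app Q u0) x = 0.
  move=> Ox.
  rewrite (eq_on_transposed (transposed_comp (tr _ _ B) (tr _ _ Q))
    (transposed_comp (tr _ _ S) (tr _ _ A)) BQ oO su0 Ox).
  by rewrite (eq_on_ldo_app S oO Au0 Ox) ldo_app0.
have PQu0 x : Omega x -> ldo_app P (ldo_app Q u0) x = u0 x.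
  move=> Ox; rewrite -[RHS](eq_on_transposed (transposed_add
    (transposed_comp (tr _ _ P) (tr _ _ Q)) (transposed_comp (tr _ _ T) (tr _ _ A)))
    (@transposed_id R d n) PQ oO su0 Ox).
  by rewrite (eq_on_ldo_app T oO Au0 Ox) ldo_app0 addr0.
have [C C0 hC] := Ck_bounded_ldo P k cK.
(* The constant [C] may vanish; dividing by [C + 1] keeps the accuracy positive and still gives
   [C * (eps / (C + 1)) <= eps]. *)
have C1 : 0 < C + 1 by rewrite ltr_wpDl.
have eps'0 : 0 < eps / (C + 1) by rewrite divr_gt0.
have sQu0 : smooth Omega (ldo_app Q u0) by exact: smooth_ldo_app.
have z0 : exists w' : 'rV[R]_d -> 'cV[R]_p, smooth setT w' /\ forall x, (fun=> 0 : 'cV[R]_q) x = ldo_app B w' x.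
  by exists (fun=> 0); split; [exact: smooth_cst|move=> x; rewrite ldo_app0].
(* Closeness is requested in [k + ldo_ord P] derivatives because applying [P] consumes [ldo_ord P]
   of them. *)
have [vbar [V [v0 [s [dvbar [oV KV sv0 vbarV] sE Bvbar vbar_close]]]]] :=
  rungeB K (fun=> 0) (k + ldo_ord P)%N (eps / (C + 1)) pts Omega (ldo_app Q u0)
    cK z0 eps'0 ptsK oO KO sQu0 BQu0.
have lvbar j : test_linear (vbar j) by case: (dvbar j).
have dPv j : is_distribution (ldo_dist P vbar j) by exact: is_distribution_ldo.
have swj j : smooth setT (fun x => w x j 0) by exact: (proj1 (smooth_mxP _ openT) sw).
have dw j : is_distribution (dist_of_fun (fun x => w x j 0)) by exact: is_distribution_fun.
have swV : smooth V w by apply: smooth_sub sw.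
have sPv0 : smooth V (ldo_app P v0) by exact: smooth_ldo_app.
have [s' [s'E hs']] := is_dirac_comb_ldo R' (A := pts) sE.
exists (fun j phi => ldo_dist P vbar j phi + dist_of_vfun w j phi), V,
  (fun x => ldo_app P v0 x + w x), s'.
split=> //.
- by move=> j; exact: (is_distributionD (dPv j) (dw j)).
- split=> //; first exact: smoothD.
  move=> j phi tphi phiV; rewrite ldo_dist_adj//.
  rewrite /dist_of_vfun /dist_of_fun.
  have -> : (fun x => (ldo_app P v0 x + w x) j 0 * phi x) =
      (fun x => ldo_app P v0 x j 0 * phi x + w x j 0 * phi x).
    by apply/funext => x; rewrite mxE mulrDl.
  rewrite integral_testD; first last.
  + exact: test_mul.
  + exact: test_mul_entry oV sPv0 tphi phiV.
  congr (_ + _); rewrite (integral_adj P j oV sv0 tphi phiV); apply: eq_bigr => l _.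
  apply: vbarV; first exact: test_adj.
  by apply: subset_trans phiV; exact: support_adj.
- move=> i phi tphi.
  have subT (psi : 'rV[R]_d -> R) : support_of psi `<=` setT by [].
  rewrite ldo_dist_adj//; last by move=> j; case: (is_distributionD (dPv j) (dw j)).
  rewrite big_split /= addrC; congr (_ + _).
    rewrite /dist_of_vfun /dist_of_fun -(integral_adj A i openT sw tphi (@subT phi)).
    by congr integral_Rd; apply/funext => x; rewrite fw.
  rewrite -hs'// ldo_dist_adj//; last by move=> j; exact: test_linear_dirac_comb.
  (* Linearity of [vbar l] gathers the sum over the intermediate index, so the transpose of the
     composite AP appears as a single test function. *)
  transitivity (\sum_l vbar l (fun x => \sum_(j < n) adj P j l (adj A i j phi) x)).
    rewrite (eq_bigr (fun j => \sum_l vbar l (adj P j l (adj A i j phi)))); last first.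
      by move=> j _; rewrite ldo_dist_adj//; exact: test_adj.
    rewrite exchange_big /=; apply: eq_bigr => l _.
    by rewrite (test_linear_sum (lvbar l))// => j _; apply: test_adj; exact: test_adj.
  (* The transposes of AP and R'B agree as functions, so [vbar l] is evaluated at the same argument
     even though it is not a smooth function globally. *)
  transitivity (\sum_l vbar l (fun x => \sum_(j < q) adj B j l (adj R' i j phi) x)).
    apply: eq_bigr => l _; congr (vbar l).
    exact: (eq_transposed (transposed_comp (tr _ _ A) (tr _ _ P))
      (transposed_comp (tr _ _ R') (tr _ _ B)) AP i l tphi).
  transitivity (\sum_j ldo_dist B vbar j (adj R' i j phi)).
    rewrite [RHS](eq_bigr (fun j => \sum_l vbar l (adj B j l (adj R' i j phi)))); last first.
      by move=> j _; rewrite ldo_dist_adj//; exact: test_adj.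
    rewrite exchange_big /=; apply: eq_bigr => l _.
    by rewrite (test_linear_sum (lvbar l))// => j _; apply: test_adj; exact: test_adj.
  apply: eq_bigr => j _; rewrite Bvbar; last exact: test_adj.
  rewrite /dist_of_vfun /dist_of_fun.
  have -> : (fun x : 'rV[R]_d => (0 : 'cV[R]_q) j 0 * adj R' i j phi x) = (fun=> 0).
    by apply/funext => x; rewrite mxE mul0r.
  by rewrite integral_test0 add0r.
(* [v0] is controlled on [V] and [ldo_app Q u0] on [Omega]; their difference can be differentiated
   on the intersection, still a neighbourhood of [K]. *)
- pose W := V `&` Omega.
  have oW : open W by exact: openI.
  have KW : K `<=` W by move=> x Kx; split; [exact: KV|exact: KO].
  have [WV WO] : W `<=` V /\ W `<=` Omega by split=> x [].
  pose z x := v0 x - ldo_app Q u0 x.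
  have sz : smooth W z by apply: smoothB => //; [apply: smooth_sub sv0|apply: smooth_sub sQu0].
  (* Since P Q u0 = u0 = u - w on [Omega], the final error is exactly [P] applied to the error made
     for B. *)
  have Pz x : W x -> ldo_app P z x = ldo_app P v0 x + w x - u x.
    move=> Wx; rewrite (ldo_appB P oW (smooth_sub WV sv0) (smooth_sub WO sQu0) Wx).
    by rewrite PQu0; [rewrite /u0 opprB addrA|exact: WO].
  have hz : forall j, Ck_bounded (k + ldo_ord P) K (fun x => z x j 0) (eps / (C + 1)).
    by apply/(Ck_norm_mx_bounded _ oW KW sz (ltW eps'0)).
  have svu : smooth W (fun x => ldo_app P v0 x + w x - u x).
    have sPz : smooth W (ldo_app P z) by exact: smooth_ldo_app.
    exact: (smooth_ext oW Pz sPz).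
  apply/(Ck_norm_mx_bounded _ oW KW svu (ltW eps0)) => a.
  have Pza x : W x -> ldo_app P z x a 0 = (ldo_app P v0 x + w x - u x) a 0 by move=> /Pz ->.
  apply: (Ck_bounded_ext oW KW Pza).
  apply: Ck_bounded_ler (hC W z _ oW KW sz (ltW eps'0) hz a).
  by rewrite mulrA ler_pdivrMr// mulrC ler_wpM2l ?ltW// ltrDl.
Qed.
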